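(* Let $W$ be an irreducible and ergodic transition matrix on a finite set $\mathcal X$, let $g_1,\dots,g_d$ be linearly independent under $W$, and let $\{W_{\vec\theta}\}_{\vec\theta\in\mathbb R^d}$ be the exponential family of transition matrices generated by $W$ with the generator $\{g_1,\dots,g_d\}$, with potential function $\phi$. Let $\{P_{\vec\theta}\}_{\vec\theta}$ be a family of initial distributions on $\mathcal X$ smoothly parametrized by $\vec\theta$. Let $J^n_{\vec\theta}$ and $\tilde J^n_{\vec\theta}$ be the Fisher information matrices of the family of distributions $\{W_{\vec\theta}^{\times n}\times P_{\vec\theta}\}_{\vec\theta}$ on $\mathcal X^{n+1}$ for the natural parameter $\vec\theta$ and for the expectation parameter $\vec\eta$, respectively, at the point $\vec\theta$. Then for every $\vec\theta$ $$\lim_{n\to\infty}\frac{J^n_{\vec\theta}}{n}=\mathsf H_{\vec\theta}[\phi],\qquad \lim_{n\to\infty}\frac{\tilde J^n_{\vec\theta}}{n}=\mathsf H_{\vec\theta}[\phi]^{-1}.$$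
   Context: A transition matrix on a finite set $\mathcal X$ is a nonnegative matrix $W(x|x')$ with $\sum_x W(x|x')=1$ for every $x'$; $\mathcal X^2_W:=\{(x,x'):W(x|x')>0\}$. It acts on column vectors by $v\mapsto\sum_{x'}W(x|x')v(x')$. $W$ is irreducible if for all $x,x'$ there is $n$ with $W^n(x|x')>0$, and ergodic if it is irreducible and aperiodic. Functions $g_1,\dots,g_d:\mathcal X\times\mathcal X\to\mathbb R$ are linearly independent under $W$ if for no non-zero $(c_1,\dots,c_d)\in\mathbb R^d$ do there exist $f:\mathcal X\to\mathbb R$ and $c\in\mathbb R$ with $\sum_j c_jg_j(x,x')=f(x)-f(x')+c$ for all $(x,x')\in\mathcal X_W^2$. Exponential family: for $\vec\theta\in\mathbb R^d$ let $\overline W_{\vec\theta}(x|x'):=W(x|x')e^{\sum_j\theta^jg_j(x,x')}$, let $\lambda_{\vec\theta}$ be its Perron–Frobenius eigenvalue, $\phi(\vec\theta):=\log\lambda_{\vec\theta}$ (potential function), and $\overline P^3_{\vec\theta}$ the positive Perron–Frobenius eigenvector of $\overline W_{\vec\theta}^T$. Put $W_{\vec\theta}(x|x'):=\lambda_{\vec\theta}^{-1}\overline P^3_{\vec\theta}(x)\overline W_{\vec\theta}(x|x')\overline P^3_{\vec\theta}(x')^{-1}$. $\mathsf H_{\vec\theta}[\phi]$ is the Hesse matrix of $\phi$ at $\vec\theta$; $\vec\theta$ is the natural parameter and $\eta_j(\vec\theta):=\frac{\partial\phi}{\partial\theta^j}(\vec\theta)$ the expectation parameter, the map $\vec\theta\mapsto\vec\eta(\vec\theta)$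 being injective with invertible Jacobian. $W_{\vec\theta}^{\times n}\times P_{\vec\theta}(x_{n+1},\dots,x_1):=W_{\vec\theta}(x_{n+1}|x_n)\cdots W_{\vec\theta}(x_2|x_1)P_{\vec\theta}(x_1)$. Fisher information is the expectation of the products of the partial derivatives of the log-likelihood, taken over the support of the distribution. *)

(* Defs.v *)
From mathcomp Require Import all_boot all_order all_algebra.
From mathcomp Require Import all_classical all_reals all_analysis.
From mathcomp Require Import complex.

Set Implicit Arguments.
Unset Strict Implicit.
Unset Printing Implicit Defensive.

Import Order.TTheory GRing.Theory Num.Theory numFieldNormedType.Exports.

Local Open Scope classical_set_scope.
Local Open Scope ring_scope.

(* A matrix A indexed by a finite type X is a function X -> X -> R;
   A x x' stands for A(x|x'), with the output state x as the row index. *)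
Section Transition.
Context {R : realType} {X : finType}.
Implicit Types A W : X -> X -> R.

Definition mx_of A : 'M[R]_#|X| :=
  \matrix_(i, j) A (enum_val i) (enum_val j).

Definition mx_power A (n : nat) (x x' : X) : R :=
  (mx_of A ^+ n) (enum_rank x) (enum_rank x').

Definition transition_matrix W : Prop :=
  (forall x x', 0 <= W x x') /\ (forall x', \sum_x W x x' = 1).

Definition irreducible A : Prop :=
  forall x x', exists n : nat, 0 < mx_power A n x x'.

(* The gcd of the return times to each state is 1. The value n = 0, which is
   divisible by everything, has no effect on the common divisors. *)
Definition aperiodic A : Prop :=
  forall x (k : nat),
    (forall n : nat, 0 < mx_power A n x x -> (k %| n)%N) -> k = 1%N.

Definition ergodic A : Prop := irreducible A /\ aperiodic A.

Definition linearly_independent_under W {d : nat} (g : 'I_d -> X -> X -> R) :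
    Prop :=
  forall c : 'rV[R]_d, c != 0 ->
  ~ exists (f : X -> R) (c0 : R), forall x x', 0 < W x x' ->
      \sum_j c 0 j * g j x x' = f x - f x' + c0.

(* The spectral radius: the supremum of the moduli of the complex eigenvalues. *)
Definition pf_eigenvalue A : R :=
  sup [set r | exists2 z : R[i],
    eigenvalue (map_mx (real_complex R) (mx_of A)) z & r = Normc.normc z].

Definition is_pf_eigenvector A (v : X -> R) : Prop :=
  (forall x, 0 < v x) /\
  (forall x, \sum_x' A x x' * v x' = pf_eigenvalue A * v x).

(* For irreducible nonnegative A this eigenvector exists and is unique up to a
   positive factor, which cancels in exp_family; one of them is chosen. *)
Definition pf_eigenvector A : {ffun X -> R} :=
  xget [ffun=> 0] [set v : {ffun X -> R} | is_pf_eigenvector A v].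

End Transition.

Section Calculus.
Context {R : realType} {d : nat}.
Implicit Types (f : 'rV[R]_d -> R) (t : 'rV[R]_d).

Definition partial (i : 'I_d) f : 'rV[R]_d -> R := 'D_(delta_mx 0 i) f.

Definition hessian f t : 'M[R]_d := \matrix_(i, j) partial i (partial j f) t.

(* C^infinity: every iterated partial derivative is differentiable. *)
Definition smooth f : Prop :=
  forall (s : seq 'I_d) t, differentiable (foldr partial f s) t.

Definition fisher_information {T : finType} (p : 'rV[R]_d -> T -> R) t :
    'M[R]_d :=
  \matrix_(i, j) \sum_(w | 0 < p t w)
    p t w * (partial i (fun u => ln (p u w)) t *
             partial j (fun u => ln (p u w)) t).

End Calculus.

Section ExponentialFamily.
Context {R : realType} {X : finType} {d : nat}.
Variables (W : X -> X -> R) (g : 'I_d -> X -> X -> R).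
Implicit Type t : 'rV[R]_d.

Definition tilted t (x x' : X) : R :=
  W x x' * expR (\sum_j t 0 j * g j x x').

Definition potential t : R := ln (pf_eigenvalue (tilted t)).

Definition pf_left t : X -> R := pf_eigenvector (fun x x' => tilted t x' x).

Definition exp_family t (x x' : X) : R :=
  (pf_eigenvalue (tilted t))^-1 * pf_left t x * tilted t x x' *
  (pf_left t x')^-1.

Definition expectation_param t : 'rV[R]_d := \row_j partial j potential t.

(* The inverse of expectation_param, with junk value 0 outside of its image. *)
Definition natural_param : 'rV[R]_d -> 'rV[R]_d :=
  'pinv_(fun=> 0) setT expectation_param.

End ExponentialFamily.

Definition distribution_family {R : realType} {X : finType} {d : nat}
    (P : 'rV[R]_d -> X -> R) : Prop :=
  forall t, (forall x, 0 <= P t x) /\ \sum_x P t x = 1.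

(* The trajectory w lists the states in order of time: w i is x_(i+1). *)
Definition path_distribution {R : realType} {X : finType}
    (W : X -> X -> R) (P : X -> R) (n : nat) (w : {ffun 'I_n.+1 -> X}) : R :=
  (\prod_(k < n) W (w (lift ord0 k)) (w (widen_ord (leqnSn n) k))) * P (w ord0).

(* Main.v *)
Require Import Defs.
From mathcomp Require Import all_boot all_order all_algebra.
From mathcomp Require Import all_classical all_reals all_analysis.
From mathcomp Require Import complex ring lra.

(** Write [W_t(x|x') = W(x|x') exp (t.g(x,x') - phi t + L x t - L x' t)], where
[L] is the logarithm of a normalized left Perron-Frobenius eigenvector.  The
score of a transition is [a_i = g_i - d_i phi + d_i L x - d_i L x'], and
differentiating [sum_x W_t(x|x') = 1] twice gives [sum_x W_t a_i = 0] and
[sum_x W_t a_i a_j = H_ij + h x' - sum_x W_t h x] with [h = d_i d_j L].  Hence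
the score of a trajectory is a sum of martingale increments whose covariances
are [H_ij] up to a coboundary that telescopes: [J^n = n H + O(1)], without any
mixing argument.

Smoothness of the eigendata is bootstrapped.  If [1] is the all-one matrix, the
normalized eigenvectors of [B_t] are [1 M_t^-1] and [M_t^-1 1], where
[M_t = B_t - lambda_t + 1] is invertible, so they are as smooth as [lambda];
and [d_i lambda = l (d_i B) r / (l r)] makes [lambda] one degree smoother than
[l] and [r].

Averaging the second identity against a stationary distribution shows that [H]
is positive definite, so that [eta = grad phi] is injective, locally onto, and
its inverse has derivative [H^-1] at [eta t]; the second limit is then
[H^-1 H H^-T]. *)

Set Implicit Arguments.
Unset Strict Implicit.
Unset Printing Implicit Defensive.

Import Order.TTheory GRing.Theory Num.Theory numFieldNormedType.Exports.

Local Open Scope classical_set_scope.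
Local Open Scope ring_scope.

(** * Perron-Frobenius theory of irreducible nonnegative matrices *)

Section PerronFrobenius.
Context {R : realType} {n : nat}.
Implicit Types (A : 'M[R]_n) (v : 'cV[R]_n).

Definition nonneg_mx A := forall i j, 0 <= A i j.
Definition irreducible_mx A := forall i j, exists k : nat, 0 < (A ^+ k) i j.

Lemma nonneg_mxX A k : nonneg_mx A -> nonneg_mx (A ^+ k).
Proof.
move=> A0; elim: k => [|k IH] i j.
  by rewrite expr0 mxE ler0n.
by rewrite exprS mxE sumr_ge0 // => l _; rewrite mulr_ge0.
Qed.

(** A sum of powers of [A] long enough to reach every exponent supplied by irreducibility; being a
    polynomial in [A], it commutes with [A]. *)
Lemma irreducible_mx_commuting_pos A : nonneg_mx A -> irreducible_mx A ->
  exists S : 'M[R]_n, (forall i j, 0 < S i j) /\ S *m A = A *m S.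
Proof.
move=> A0 Airr.
have [k kP] := choice (fun ij : 'I_n * 'I_n => Airr ij.1 ij.2).
pose N := (\max_ij k ij).+1.
exists (\sum_(m < N) A ^+ m); split=> [i j|].
  have kN : (k (i, j) < N)%N by rewrite ltnS leq_bigmax.
  rewrite summxE (bigD1 (Ordinal kN)) //= ltr_wpDr ?(kP (i, j)) //.
  by rewrite sumr_ge0 // => m _; apply: nonneg_mxX.
rewrite mulmx_suml mulmx_sumr; apply: eq_bigr => m _.
by rewrite -!/(_ * _) -exprSr -exprS.
Qed.

Lemma irreducible_mx_tr A : irreducible_mx A -> irreducible_mx A^T.
Proof.
move=> Airr i j; have [k kP] := Airr j i; exists k.
suff -> : A^T ^+ k = (A ^+ k)^T by rewrite mxE.
elim: k {kP} => [|k IH]; first by rewrite !expr0 trmx1.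
by rewrite exprS exprSr trmx_mul -IH.
Qed.

Lemma pos_mulmx_gt0 (S : 'M[R]_n) v : (forall i j, 0 < S i j) ->
  (forall i, 0 <= v i 0) -> v != 0 -> forall i, 0 < (S *m v) i 0.
Proof.
move=> S0 v0 vn0 i.
have [j vj] : exists j, 0 < v j 0.
  apply/existsP; apply: contraNT vn0 => /existsPn vle0.
  apply/eqP/colP => j; rewrite mxE; apply: le_anti.
  by rewrite v0 andbT leNgt vle0.
rewrite mxE (bigD1 j) //= ltr_wpDr ?mulr_gt0 //.
by rewrite sumr_ge0 // => l _; rewrite mulr_ge0 // ltW.
Qed.

(** The reciprocal of the sum of all ratios [b i / a i] works, since each ratio is at most the sum;
    [i0] makes the sum positive. *)
Lemma exists_scale_le (i0 : 'I_n) (a b : 'I_n -> R) :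
  (forall i, 0 < a i) -> (forall i, 0 < b i) ->
  exists2 e : R, 0 < e & forall i, e * b i <= a i.
Proof.
move=> a0 b0.
have ba0 i : 0 < b i / a i by rewrite divr_gt0.
have s0 : 0 < \sum_i b i / a i.
  rewrite (bigD1 i0) //= ltr_wpDr // sumr_ge0 // => i _; exact: ltW.
exists (\sum_i b i / a i)^-1; first by rewrite invr_gt0.
move=> i; rewrite mulrC ler_pdivrMr // mulrC -ler_pdivrMr //.
rewrite (bigD1 i) //= lerDl sumr_ge0 // => j _; exact: ltW.
Qed.

Lemma closed_le_continuous (T : topologicalType) (f g : T -> R) :
  continuous f -> continuous g -> closed [set x | f x <= g x].
Proof.
move=> cf cg.
rewrite (_ : [set _ | _] = (g - f) @^-1` [set y | 0 <= y]).
  apply: preimage_closed; last exact: closed_ge.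
  by move=> x _; apply: cvgB; [exact: cg|exact: cf].
by apply/seteqP; split=> x /=; rewrite !fctE subr_ge0.
Qed.

Lemma continuous_sum_mulr (T : topologicalType) (c : 'I_n -> R)
    (f : 'I_n -> T -> R) :
  (forall i, continuous (f i)) -> continuous (fun x => \sum_i c i * f i x).
Proof.
move=> cf x; apply: cvg_big => [|i _]; first exact: add_continuous.
by apply: cvgM; [exact: cvg_cst|exact: cf].
Qed.

(** The first [n] coordinates hold a point [v] of the simplex and the last one a number [r >= 0]
    with [r v <= A v]; one row vector for both lets the extreme value theorem apply to the pair. *)
Let in_collatz_set A (u : 'rV[R]_(n + 1)) : Prop :=
  [/\ forall i, 0 <= u 0 (lshift 1 i),
      \sum_i u 0 (lshift 1 i) = 1,
      0 <= u 0 (rshift n 0) &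
      forall i, u 0 (rshift n 0) * u 0 (lshift 1 i) <=
        \sum_j A i j * u 0 (lshift 1 j)].

Let collatz_set_compact A : nonneg_mx A -> compact [set u | in_collatz_set A u].
Proof.
move=> A0; apply: bounded_closed_compact.
  have [] : exists M : R, 1 <= M /\ \sum_i \sum_j A i j <= M.
    exists (1 + \sum_i \sum_j A i j); rewrite lerDl lerDr ler01; split=> //.
    by apply: sumr_ge0 => i _; apply: sumr_ge0.
  move=> M [M1 AM].
  exists M; split=> [|M' /ltW MM' u [u0 u1 r0 ur]]; first exact: num_real.
  apply: le_trans MM'.
  have M0 : 0 <= M by exact: le_trans M1.
  have ule1 i : u 0 (lshift 1 i) <= 1.
    rewrite -u1 (bigD1 i) //= lerDl; exact: sumr_ge0.
  rewrite [leLHS]/Num.Def.normr /= mx_normrE; apply/bigmax_leP; split=> // -[i j] _ /=.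
  rewrite ord1; case: (split_ordP j) => [k ->|k ->].
    by rewrite ger0_norm // (le_trans (ule1 k)).
  (* Summing [r v_i <= (A v)_i] over [i], with [v_j <= 1], bounds [r] by the sum of the entries of
     [A]. *)
  rewrite ord1 ger0_norm // -[leLHS]mulr1 -u1 mulr_sumr (le_trans _ AM) //.
  apply: ler_sum => m _; apply: le_trans (ur m) _.
  by apply: ler_sum => l _; rewrite ler_piMr.
have cc k : continuous (fun u : 'rV[R]_(n + 1) => u 0 k) by apply: coord_continuous.
rewrite (_ : [set _ | _] =
  (\bigcap_i [set u : 'rV[R]_(n + 1) | 0 <= u 0 (lshift 1 i)]) `&`
  ([set u : 'rV[R]_(n + 1) | \sum_i 1 * u 0 (lshift 1 i) <= 1] `&`
   [set u : 'rV[R]_(n + 1) | 1 <= \sum_i 1 * u 0 (lshift 1 i)]) `&`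
  [set u : 'rV[R]_(n + 1) | 0 <= u 0 (rshift n 0)] `&`
  \bigcap_i [set u : 'rV[R]_(n + 1) | u 0 (rshift n 0) * u 0 (lshift 1 i) <=
        \sum_j A i j * u 0 (lshift 1 j)]).
  apply: closedI; [apply: closedI; [apply: closedI|]|].
  - by apply: closed_bigI => i _; apply: closed_le_continuous => //; apply: cst_continuous.
  - by apply: closedI; apply: closed_le_continuous; try exact: cst_continuous;
      apply: continuous_sum_mulr.
  - by apply: closed_le_continuous => //; apply: cst_continuous.
  - apply: closed_bigI => i _; apply: closed_le_continuous.
      by move=> x; apply: continuousM; exact: cc.
    exact: continuous_sum_mulr.
apply/seteqP; split=> u.
  case=> u0 u1 r0 ur; split=> [|i _]; last exact: ur.
  split=> //; split=> [i _|]; first exact: u0.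
  by split=> /=; under eq_bigr do rewrite mul1r; rewrite u1.
case=> -[[u0 [/= u1 u1']]] r0 ur; split=> //.
- by move=> i; apply: u0.
- move: u1 u1'; under eq_bigr do rewrite mul1r.
  by move=> u1 u1'; apply/eqP; rewrite eq_le u1.
- by move=> i; apply: ur.
Qed.

(* The largest r such that A v >= r v for some v in the simplex is attained
   (Collatz-Wielandt); if A v <> r v, applying a positive matrix that
   commutes with A makes the inequality strict and contradicts maximality. *)
Lemma perron_frobenius (i0 : 'I_n) A : nonneg_mx A -> irreducible_mx A ->
  exists (r : R) v, (forall i, 0 < v i 0) /\ A *m v = r *: v.
Proof.
move=> A0 Airr.
have [S [S0 SA]] := irreducible_mx_commuting_pos A0 Airr.
have [u [u0 u1 r0 ur] umax] : exists2 u, in_collatz_set A u &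
    forall u', in_collatz_set A u' -> u' 0 (rshift n 0) <= u 0 (rshift n 0).
  have Kn0 : [set u | in_collatz_set A u] !=set0.
    exists (row_mx (delta_mx 0 i0) 0).
    have rE i : (row_mx (delta_mx 0 i0) 0 : 'rV[R]_(n + 1)) 0 (lshift 1 i) = (i == i0)%:R.
      by rewrite row_mxEl mxE eqxx.
    split=> [i||| i]; rewrite ?rE ?ler0n ?row_mxEr ?mxE ?mul0r //.
      rewrite (bigD1 i0) //= rE eqxx big1 ?addr0 // => i /negbTE ni.
      by rewrite rE ni.
    by apply: sumr_ge0 => j _; rewrite rE mulr_ge0 // ler0n.
  have [u uK umax] := @EVT_max_rV R _ (fun u => u 0 (rshift n 0)) _ Kn0
    (collatz_set_compact A0) (continuous_subspaceT (@coord_continuous _ _ _ _ _)).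
  exists u; first by move: uK; rewrite inE.
  by move=> u' u'K; apply: umax; rewrite inE.
pose r := u 0 (rshift n 0).
pose x : 'cV[R]_n := \col_i u 0 (lshift 1 i).
have x0 i : 0 <= x i 0 by rewrite mxE.
have xn0 : x != 0.
  apply/eqP => /colP xE; move: u1; rewrite big1 => [/esym/eqP|i _].
    by rewrite oner_eq0.
  by have := xE i; rewrite !mxE.
have y0 := pos_mulmx_gt0 S0 x0 xn0.
have Sw : S *m (A *m x - r *: x) = A *m (S *m x) - r *: (S *m x).
  by rewrite mulmxBr !mulmxA SA scalemxAr.
have [w0|wn0] := eqVneq (A *m x - r *: x) 0.
  exists r, (S *m x); split=> //.
  by apply/eqP; rewrite -subr_eq0 -Sw w0 mulmx0.
have w_ge0 i : 0 <= (A *m x - r *: x) i 0.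
  rewrite !mxE subr_ge0; apply: le_trans (ur i) _.
  by apply: ler_sum => j _; rewrite mxE.
have Sw0 := pos_mulmx_gt0 S0 w_ge0 wn0.
have [e e0 eP] := exists_scale_le i0 Sw0 y0.
pose y := S *m x; pose s := \sum_i y i 0.
have s0 : 0 < s.
  by rewrite /s (bigD1 i0) //= ltr_wpDr ?y0 // sumr_ge0 // => i _; exact/ltW/y0.
(* The bound [S (A x - r x) >= e y] reads [A y >= (r + e) y], so [y] rescaled to the simplex would
   admit the value [r + e]. *)
have /umax : in_collatz_set A (row_mx (s^-1 *: y^T) (const_mx (r + e))).
  have lE i : (row_mx (s^-1 *: y^T) (const_mx (r + e)) : 'rV[R]_(n + 1))
      0 (lshift 1 i) = s^-1 * y i 0.
    by rewrite row_mxEl !mxE.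
  have rE : (row_mx (s^-1 *: y^T) (const_mx (r + e)) : 'rV[R]_(n + 1))
      0 (rshift n 0) = r + e.
    by rewrite row_mxEr !mxE.
  split; rewrite ?rE.
  - by move=> i; rewrite lE mulr_ge0 ?invr_ge0 ?(ltW s0) //; exact/ltW/y0.
  - under eq_bigr do rewrite lE.
    by rewrite -mulr_sumr mulVf // gt_eqF.
  - by rewrite addr_ge0 // ltW.
  - move=> i; under eq_bigr do rewrite lE mulrCA.
    rewrite lE -mulr_sumr mulrCA ler_pM2l ?invr_gt0 //.
    have h : e * y i 0 <= (A *m y) i 0 - r * y i 0.
      have -> : (A *m y) i 0 - r * y i 0 = (A *m y - r *: y) i 0 by rewrite !mxE.
      by rewrite -Sw; apply: eP.
    have -> : \sum_i0 A i i0 * y i0 0 = (A *m y) i 0 by rewrite mxE.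
    by rewrite mulrDl -lerBrDl.
by rewrite row_mxEr mxE -/r gerDl leNgt e0.
Qed.

(** Subtracting from [v'] the largest multiple of [v] below it leaves a nonnegative eigenvector with
    a zero coordinate. If it were nonzero, some power of [A], which only rescales it, would make
    that coordinate positive. *)
Lemma perron_frobenius_unique (i0 : 'I_n) A (r : R) v v' :
  nonneg_mx A -> irreducible_mx A -> (forall i, 0 < v i 0) ->
  A *m v = r *: v -> A *m v' = r *: v' -> exists c, v' = c *: v.
Proof.
move=> A0 Airr v0 Av Av'.
have [S [S0 SA]] := irreducible_mx_commuting_pos A0 Airr.
case: (@Order.TotalTheory.arg_minP _ _ _ i0 xpredT (fun i => v' i 0 / v i 0) isT)
  => i _ imin.
pose c := v' i 0 / v i 0; exists c.
apply/eqP; rewrite -subr_eq0; apply/negPn/negP => wn0.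
set w := v' - c *: v in wn0.
have w0 j : 0 <= w j 0.
  by rewrite !mxE subr_ge0 -ler_pdivlMr ?v0 // imin.
have wi : w i 0 = 0.
  by rewrite !mxE /c mulfVK ?subrr // gt_eqF.
have Aw : A *m w = r *: w.
  by rewrite mulmxBr -scalemxAr Av Av' scalerBr !scalerA mulrC.
have [j wj] : exists j, 0 < w j 0.
  apply/existsP; apply: contraNT wn0 => /existsPn wle0.
  apply/eqP/colP => j; rewrite [RHS]mxE; apply: le_anti.
  by rewrite w0 andbT leNgt wle0.
have [k kP] := Airr i j.
have Akw : A ^+ k *m w = r ^+ k *: w.
  elim: k {kP} => [|k IH]; first by rewrite !expr0 mul1mx scale1r.
  by rewrite exprSr -mulmxA Aw -scalemxAr IH scalerA -exprS.
have : 0 < (A ^+ k *m w) i 0.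
  rewrite mxE (bigD1 j) //= ltr_wpDr ?mulr_gt0 // sumr_ge0 // => l _.
  by rewrite mulr_ge0 //; exact: nonneg_mxX.
by rewrite Akw mxE wi mulr0 ltxx.
Qed.

(** The number [r] is an eigenvalue through [l]. For a complex row eigenvector [u] of eigenvalue
    [z], the triangle inequality gives [|z| |u_j| <= sum_i |u_i| A_ij], and pairing with the
    positive [v] yields [|z| <= r]. *)
Lemma pf_radius (i0 : 'I_n) A (r : R) (l : 'rV[R]_n) v :
  nonneg_mx A -> (forall i, 0 < l 0 i) -> (forall i, 0 < v i 0) ->
  l *m A = r *: l -> A *m v = r *: v ->
  sup [set x | exists2 z : R[i], eigenvalue (map_mx (real_complex R) A) z &
         x = Normc.normc z] = r.
Proof.
move=> A0 l0 v0 lA Av.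
have r0 : 0 <= r.
  have := congr1 (fun u : 'cV_n => u i0 0) Av; rewrite !mxE => h.
  rewrite -(pmulr_lge0 _ (v0 i0)) -h sumr_ge0 // => j _.
  by rewrite mulr_ge0 // ltW.
set E := [set _ | _].
have Er : E r.
  exists (real_complex R r); last by rewrite /= expr0n addr0 sqrtr_sqr ger0_norm.
  apply/eigenvalueP; exists (map_mx (real_complex R) l).
    by rewrite -map_mxM lA map_mxZ.
  apply/eqP => /rowP/(_ i0); rewrite !mxE => -[/eqP].
  by rewrite gt_eqF // l0.
have Eub : ubound E r.
  move=> _ [z /eigenvalueP[u uA un0] ->].
  pose m i := Normc.normc (u 0 i).
  have m0 i : 0 <= m i by rewrite /m; case: (u 0 i) => a b; exact: sqrtr_ge0.
  have s0 : 0 < \sum_i m i * v i 0.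
    have [i ui] : exists i, u 0 i != 0.
      apply/existsP; apply: contraNT un0 => /existsPn h.
      by apply/eqP/rowP => i; rewrite mxE; apply/eqP; rewrite -[_ == _]negbK.
    rewrite (bigD1 i) //= ltr_wpDr //.
      by apply: sumr_ge0 => j _; rewrite mulr_ge0 // ltW.
    rewrite mulr_gt0 // lt0r m0 andbT.
    by apply: contra_neq ui; exact: Normc.eq0_normc.
  rewrite -(ler_pM2r s0).
  have step j : Normc.normc z * m j <= \sum_i m i * A i j.
    rewrite /m -Normc.normcM.
    have -> : z * u 0 j = \sum_i u 0 i * real_complex R (A i j).
      have := congr1 (fun w : 'rV_n => w 0 j) uA; rewrite !mxE => <-.
      by apply: eq_bigr => i _; rewrite mxE.
    elim/big_ind2 : _ => [|x1 x2 y1 y2 h1 h2|i _].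
    - by rewrite Normc.normc0.
    - by apply: le_trans (le_normcD _ _) _; rewrite lerD.
    - by rewrite Normc.normcM /= expr0n addr0 sqrtr_sqr ger0_norm.
  rewrite mulr_sumr (le_trans (y := \sum_j (\sum_i m i * A i j) * v j 0)) //.
    by apply: ler_sum => j _; rewrite mulrA ler_wpM2r // ltW.
  under eq_bigr do rewrite mulr_suml.
  rewrite exchange_big /= mulr_sumr; apply: ler_sum => i _.
  under eq_bigr do rewrite -mulrA.
  rewrite -mulr_sumr mulrCA ler_wpM2l //.
  have := congr1 (fun u : 'cV_n => u i 0) Av; rewrite !mxE => ->.
  exact: lexx.
apply: le_anti; apply/andP; split.
  by apply: ge_sup => //; exists r.
by apply: ub_le_sup => //; exists r.
Qed.

End PerronFrobenius.

(** * Functions of class C^n on R^d *)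

Section DifferentialEpsilon.
Context {R : realType} {V W : normedModType R}.
Implicit Types (f : V -> W) (x : V).

(** Epsilon form of the differential, which combines directly with norm estimates. *)
Lemma diff_eps f x : differentiable f x -> forall e, 0 < e ->
  \forall y \near x, `|f y - f x - 'd f x (y - x)| <= e * `|y - x|.
Proof.
move=> df e e0; have /eqaddoP/(_ e e0) h := diff_locally df.
rewrite (near_shift 0 x); apply: filterS h => y /=.
by rewrite !fctE /= subr0 addrK opprD addrA.
Qed.

Lemma eps_diff f x (l : {linear V -> W}) : continuous l ->
  (forall e, 0 < e -> \forall y \near x, `|f y - f x - l (y - x)| <= e * `|y - x|) ->
  differentiable f x /\ 'd f x = l :> (V -> W).
Proof.
move=> cl H.
have E : f \o shift x = cst (f x) + l +o_ 0 id.
  apply/eqaddoP => e e0; have := H e e0.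
  rewrite (near_shift 0 x); apply: filterS => y /=.
  by rewrite !fctE /= subr0 addrK opprD addrA.
have D : 'd f x = l :> (V -> W) by exact: diff_unique.
by split=> //; apply/diff_locallyP; rewrite D.
Qed.

End DifferentialEpsilon.

Section ClassCn.
Context {R : realType} {d : nat}.
Implicit Types (f g : 'rV[R]_d -> R) (t : 'rV[R]_d).

(** Recursion on first partial derivatives reduces closure under an operation to induction on [n],
    once its partial derivatives are computed. *)
Fixpoint Cn (n : nat) f : Prop :=
  if n is m.+1 then
    (forall t, differentiable f t) /\ forall i, Cn m (partial i f)
  else continuous f.

Lemma Cn_differentiable n f t : Cn n.+1 f -> differentiable f t.
Proof. by case. Qed.

Lemma CnW n f : Cn n.+1 f -> Cn n f.
Proof.
elim: n f => [|n IH] f [df pf]; first by move=> t; exact/differentiable_continuous/df.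
by split=> // i; exact/IH/pf.
Qed.

Lemma Cn_continuous n f : Cn n f -> continuous f.
Proof. by elim: n => [//|n IH] /CnW. Qed.

Lemma Cn_cst n (c : R) : Cn n (fun=> c).
Proof.
elim: n c => [|n IH] c; first exact: cst_continuous.
split=> [t|i]; first exact: differentiable_cst.
rewrite (_ : partial i _ = fun=> 0) //.
by apply/funext => t; rewrite /partial derive_cst.
Qed.

Lemma CnD n f g : Cn n f -> Cn n g -> Cn n (fun t => f t + g t).
Proof.
elim: n f g => [|n IH] f g.
  by move=> cf cg t; apply: continuousD; [exact: cf|exact: cg].
move=> [df pf] [dg pg]; split=> [t|i]; first exact: differentiableD.
rewrite (_ : partial i _ = fun t => partial i f t + partial i g t).
  exact: (IH _ _ (pf i) (pg i)).
apply/funext => t; rewrite /partial.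
rewrite deriveD; [by []| |].
all: exact: diff_derivable.
Qed.

Lemma partialD i f g t : differentiable f t -> differentiable g t ->
  partial i (fun t => f t + g t) t = partial i f t + partial i g t.
Proof.
move=> df dg; rewrite /partial deriveD //; exact: diff_derivable.
Qed.

Lemma partialN i f t : differentiable f t ->
  partial i (fun t => - f t) t = - partial i f t.
Proof. by move=> df; rewrite /partial deriveN //; exact: diff_derivable. Qed.

Lemma partial_cst i (c : R) t : partial i (fun=> c) t = 0.
Proof. by rewrite /partial derive_cst. Qed.

Lemma differentiable_bigsum (I : Type) (r : seq I) (f : I -> 'rV[R]_d -> R) t :
  (forall i, differentiable (f i) t) ->
  differentiable (fun t => \sum_(i <- r) f i t) t.
Proof.
move=> df; elim: r => [|a r IH].
  by under eq_fun do rewrite big_nil; exact: differentiable_cst.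
by under eq_fun do rewrite big_cons; exact: differentiableD.
Qed.

Lemma partial_sum (I : Type) (r : seq I) i (f : I -> 'rV[R]_d -> R) t :
  (forall i, differentiable (f i) t) ->
  partial i (fun t => \sum_(k <- r) f k t) t = \sum_(k <- r) partial i (f k) t.
Proof.
move=> df; elim: r => [|a r IH].
  by under eq_fun do rewrite big_nil; rewrite partial_cst big_nil.
under eq_fun do rewrite big_cons.
by rewrite partialD // ?IH ?big_cons //; exact: differentiable_bigsum.
Qed.

Lemma partialM i f g t : differentiable f t -> differentiable g t ->
  partial i (fun t => f t * g t) t = f t * partial i g t + g t * partial i f t.
Proof. by move=> df dg; rewrite /partial deriveM //; exact: diff_derivable. Qed.

Lemma CnM n f g : Cn n f -> Cn n g -> Cn n (fun t => f t * g t).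
Proof.
elim: n f g => [|n IH] f g.
  by move=> cf cg t; apply: continuousM; [exact: cf|exact: cg].
move=> cf cg; have [df pf] := cf; have [dg pg] := cg.
split=> [t|i]; first exact: differentiableM.
rewrite (_ : partial i _ = fun t => f t * partial i g t + g t * partial i f t).
  exact: CnD (IH _ _ (CnW cf) (pg i)) (IH _ _ (CnW cg) (pf i)).
by apply/funext => t; rewrite partialM.
Qed.

Lemma Cn_sum n (I : Type) (r : seq I) (P : pred I) (f : I -> 'rV[R]_d -> R) :
  (forall i, P i -> Cn n (f i)) -> Cn n (fun t => \sum_(i <- r | P i) f i t).
Proof.
move=> cf; elim: r => [|a r IH].
  by under eq_fun do rewrite big_nil; exact: Cn_cst.
under eq_fun do rewrite big_cons.
by have := cf a; case: (P a) => // /(_ isT) ca; exact: CnD.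
Qed.

Lemma Cn_prod n (I : Type) (r : seq I) (P : pred I) (f : I -> 'rV[R]_d -> R) :
  (forall i, P i -> Cn n (f i)) -> Cn n (fun t => \prod_(i <- r | P i) f i t).
Proof.
move=> cf; elim: r => [|a r IH].
  by under eq_fun do rewrite big_nil; exact: Cn_cst.
under eq_fun do rewrite big_cons.
by have := cf a; case: (P a) => // /(_ isT) ca; exact: CnM.
Qed.

Lemma CnN n f : Cn n f -> Cn n (fun t => - f t).
Proof.
by move=> cf; under eq_fun do rewrite -mulN1r; apply: CnM => //; exact: Cn_cst.
Qed.

Lemma CnB n f g : Cn n f -> Cn n g -> Cn n (fun t => f t - g t).
Proof. by move=> cf cg; apply: CnD => //; exact: CnN. Qed.

Lemma partialV i f t : differentiable f t -> f t != 0 ->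
  partial i (fun t => (f t)^-1) t = - ((f t)^-1 * (f t)^-1 * partial i f t).
Proof.
move=> df f0; rewrite /partial deriveV //; last exact: diff_derivable.
by rewrite /= scaleNr -[_ *: _]/(_ * _) expr2 invfM.
Qed.

Lemma CnV n f : (forall t, f t != 0) -> Cn n f -> Cn n (fun t => (f t)^-1).
Proof.
move=> f0; elim: n => [|n IH].
  by move=> cf t; exact: (cvgV (f0 t) (cf t)).
move=> cf; have [df pf] := cf; split=> [t|i]; first exact: differentiableV.
rewrite (_ : partial i _ = fun t => - ((f t)^-1 * (f t)^-1 * partial i f t)).
  by have cV := IH (CnW cf); exact: CnN (CnM (CnM cV cV) (pf i)).
by apply/funext => t; rewrite partialV.
Qed.

Lemma partial_comp i f (h : R -> R) (dh : R) t : differentiable f t ->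
  is_derive (f t) 1 h dh -> partial i (fun t => h (f t)) t = dh * partial i f t.
Proof.
move=> df [hd hE]; have dh' : differentiable h (f t) by apply/derivable1_diffP.
rewrite /partial !deriveE //; last exact: differentiable_comp.
rewrite diff_comp //= -hE deriveE // -[in LHS](mulr1 ('d f t _)).
by rewrite [LHS]linearZ mulrC.
Qed.

Lemma partial_expR i f t : differentiable f t ->
  partial i (fun t => expR (f t)) t = expR (f t) * partial i f t.
Proof. by move=> df; apply: partial_comp. Qed.

Lemma differentiable_expR f t :
  differentiable f t -> differentiable (fun t => expR (f t)) t.
Proof.
move=> df; apply: differentiable_comp => //.
by apply/derivable1_diffP; exact: derivable_expR.
Qed.

Lemma Cn_expR n f : Cn n f -> Cn n (fun t => expR (f t)).
Proof.
elim: n => [|n IH].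
  by move=> cf t; apply: continuous_comp; [exact: cf|exact: continuous_expR].
move=> cf; have [df pf] := cf; split=> [t|i]; first exact: differentiable_expR.
rewrite (_ : partial i _ = fun t => expR (f t) * partial i f t).
  exact: CnM (IH (CnW cf)) (pf i).
by apply/funext => t; rewrite partial_expR.
Qed.

Lemma differentiable_ln f t : 0 < f t ->
  differentiable f t -> differentiable (fun t => ln (f t)) t.
Proof.
move=> f0 df; apply: differentiable_comp => //.
by apply/derivable1_diffP; have [] := is_derive1_ln f0.
Qed.

Lemma Cn_ln n f : (forall t, 0 < f t) -> Cn n f -> Cn n (fun t => ln (f t)).
Proof.
move=> f0; case: n => [|n] cf.
  by move=> t; apply: continuous_comp; [exact: cf|exact: continuous_ln].
have [df pf] := cf; split=> [t|i]; first exact: differentiable_ln.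
rewrite (_ : partial i _ = fun t => (f t)^-1 * partial i f t).
  by apply: (CnM _ (pf i)); apply: CnV; [move=> t; rewrite gt_eqF|exact: CnW].
by apply/funext => t; apply: partial_comp => //; exact: is_derive1_ln.
Qed.

Lemma partial_coord i k t : partial i (fun t => t 0 k) t = (k == i)%:R.
Proof.
rewrite /partial.
have h : derivable (id : 'rV[R]_d -> _) t (delta_mx 0 i) by exact: derivable_id.
have /(congr1 (fun M : 'rV_d => M 0 k)) := derive_mx h.
by rewrite derive_id !mxE /= => <-.
Qed.

Lemma Cn_coord n k : Cn n (fun t => t 0 k).
Proof.
case: n => [|n]; first exact: coord_continuous.
split=> [t|i]; first exact: differentiable_coord.
rewrite (_ : partial i _ = fun=> (k == i)%:R); first exact: Cn_cst.
by apply/funext => t; exact: partial_coord.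
Qed.

End ClassCn.

(** * Smooth dependence of the Perron-Frobenius eigenvalue and eigenvectors *)

Section SecantDifferentiability.
Context {R : realType} {d : nat}.
Implicit Types (a b f : 'rV[R]_d -> R) (s t : 'rV[R]_d).

Lemma diff_lipschitz_at b s : differentiable b s ->
  exists2 k : R, 0 < k & \forall t \near s, `|b t - b s| <= k * `|t - s|.
Proof.
move=> db; have [k k0 kP] := linear_lipschitz (diff_continuous db).
exists (k + 1); first by rewrite addr_gt0.
have := diff_eps db ltr01; apply: filterS => t ht.
rewrite -[b t - b s](subrK ('d b s (t - s))) (le_trans (ler_normD _ _)) //.
by rewrite mulrDl addrC lerD.
Qed.

(** One factor tends to 0 and the other is [O(|t - s|)], so the product is [o(|t - s|)]. *)
Lemma differentiable_mul_increment a b s : {for s, continuous a} ->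
  differentiable b s ->
  differentiable (fun t => (a t - a s) * (b t - b s)) s /\
  forall v, 'D_v (fun t => (a t - a s) * (b t - b s)) s = 0.
Proof.
move=> ca db; pose F t := (a t - a s) * (b t - b s).
have [k k0 kP] := diff_lipschitz_at db.
have [] := @eps_diff _ _ _ F s (\0 : {linear _ -> _}).
- exact: cst_continuous.
- move=> e e0; rewrite /F.
  have ek0 : 0 < e / k by rewrite divr_gt0.
  move/cvgrPdist_le : ca => /(_ _ ek0) ca.
  near=> t; rewrite !subrr mul0r !subr0 normrM.
  rewrite (le_trans (y := (e / k) * (k * `|t - s|))) //; last first.
    by rewrite mulrA divfK // gt_eqF.
  rewrite ler_pM //; first by rewrite distrC; near: t.
  by near: t.
- by move=> dF dE; split=> // v; rewrite deriveE // dE.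
Unshelve. all: by end_near.
Qed.

(** The coefficients of the secant formula are only continuous at [s]. Splitting [a i t] as
    [(a i t - a i s) + a i s] leaves a negligible product and a linear combination of the increments
    of the [b i]. *)
Lemma secant_differentiable (I : finType) (a b : I -> 'rV[R]_d -> R) f s :
  (forall i, {for s, continuous (a i)}) -> (forall i, differentiable (b i) s) ->
  (forall t, f t - f s = \sum_i a i t * (b i t - b i s)) ->
  differentiable f s /\ forall j, partial j f s = \sum_i a i s * partial j (b i) s.
Proof.
move=> ca db fE.
pose F i t := (a i t - a i s) * (b i t - b i s) + a i s * (b i t - b i s).
have hF i : differentiable (F i) s /\ forall v, 'D_v (F i) s = a i s * 'D_v (b i) s.
  have [dh Dh] := differentiable_mul_increment (ca i) (db i).
  have dB : differentiable (fun t => b i t - b i s) s.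
    by apply: differentiableB => //; exact: differentiable_cst.
  have dG : differentiable (fun t => a i s * (b i t - b i s)) s.
    by apply: differentiableM => //; exact: differentiable_cst.
  split=> [|v]; first exact: differentiableD.
  rewrite /F deriveD; [|exact: diff_derivable|exact: diff_derivable].
  rewrite Dh add0r deriveMl; last exact: diff_derivable.
  rewrite deriveB; [|exact: diff_derivable|exact: derivable_cst].
  by rewrite derive_cst subr0.
have fEF : f = (fun t => f s + \sum_i F i t).
  apply/funext => t; rewrite -[LHS](subrK (f s)) fE addrC; congr (_ + _).
  by apply: eq_bigr => i _; rewrite /F -mulrDl subrK.
have hS : differentiable (fun t => \sum_i F i t) s /\
    forall v, 'D_v (fun t => \sum_i F i t) s = \sum_i a i s * 'D_v (b i) s.
  elim: (index_enum I) => [|i r [IH1 IH2]].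
    under eq_fun do rewrite big_nil; split=> [|v]; first exact: differentiable_cst.
    by rewrite derive_cst big_nil.
  under eq_fun do rewrite big_cons.
  have [dFi DFi] := hF i.
  split=> [|v]; first exact: differentiableD.
  rewrite deriveD; [|exact: diff_derivable|exact: diff_derivable].
  by rewrite big_cons DFi IH2.
have [dS DS] := hS; rewrite fEF; split=> [|j].
  by apply: differentiableD => //; exact: differentiable_cst.
rewrite /partial deriveD; [|exact: derivable_cst|exact: diff_derivable].
by rewrite derive_cst add0r DS.
Qed.

End SecantDifferentiability.

(** * Determinants and inverses of smooth matrix families *)

Section CnMatrix.
Context {R : realType} {d : nat}.

Lemma Cn_det k n (M : 'rV[R]_d -> 'M[R]_n) :
  (forall i j, Cn k (fun t => M t i j)) -> Cn k (fun t => \det (M t)).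
Proof.
move=> cM; rewrite /determinant; apply: Cn_sum => s _.
by apply: CnM; [exact: Cn_cst|apply: Cn_prod].
Qed.

(** Cramer's rule: each entry of the inverse is a cofactor divided by the determinant. *)
Lemma Cn_invmx k n (M : 'rV[R]_d -> 'M[R]_n) :
  (forall i j, Cn k (fun t => M t i j)) -> (forall t, M t \in unitmx) ->
  forall i j, Cn k (fun t => invmx (M t) i j).
Proof.
move=> cM uM i j.
rewrite (_ : (fun t => _) =
  fun t => (\det (M t))^-1 * ((-1) ^+ (j + i) * \det (row' j (col' i (M t))))).
  apply: CnM.
    apply: CnV; last exact: Cn_det.
    by move=> t; have := uM t; rewrite unitmxE unitfE.
  apply: CnM; first exact: Cn_cst.
  apply: Cn_det => a b; under eq_fun do rewrite !mxE; exact: cM.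
by apply/funext => t; rewrite /invmx uM !mxE.
Qed.

End CnMatrix.

(** * Eigendata of a smooth family of irreducible matrices *)

Section PerronFamily.
Context {R : realType} {d n : nat}.
Variables (i0 : 'I_n) (B : 'rV[R]_d -> 'M[R]_n) (lam : 'rV[R]_d -> R).
Variables (l : 'rV[R]_d -> 'rV[R]_n) (r : 'rV[R]_d -> 'cV[R]_n).
Hypothesis B0 : forall t, nonneg_mx (B t).
Hypothesis Birr : forall t, irreducible_mx (B t).
Hypothesis BC : forall k i j, Cn k (fun t => B t i j).
(** Closeness is relative: entries that vanish at [s] vanish nearby, and errors are measured against
    [B s] itself. *)
Hypothesis Bnear : forall s e, 0 < e -> \forall t \near s,
  forall i j, `|B t i j - B s i j| <= e * B s i j.
Hypothesis l0 : forall t i, 0 < l t 0 i.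
Hypothesis r0 : forall t i, 0 < r t i 0.
Hypothesis lB : forall t, l t *m B t = lam t *: l t.
Hypothesis Br : forall t, B t *m r t = lam t *: r t.
Hypothesis l1 : forall t, \sum_i l t 0 i = 1.
Hypothesis r1 : forall t, \sum_i r t i 0 = 1.

Let M t : 'M[R]_n := B t - (lam t)%:M + const_mx 1.

Let pairing s t := \sum_i l t 0 i * r s i 0.

Let pairing_gt0 s t : 0 < pairing s t.
Proof.
rewrite /pairing (bigD1 i0) //= ltr_wpDr ?mulr_gt0 // sumr_ge0 // => i _.
by rewrite mulr_ge0 // ltW.
Qed.

(** Sandwiching [B t - B s] between the left eigenvector at [t] and the right one at [s] gives an
    exact difference formula, free of derivatives. *)
Let lam_secant s t : (lam t - lam s) * pairing s t =
  \sum_i \sum_j l t 0 i * r s j 0 * (B t i j - B s i j).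
Proof.
have E : l t *m (B t - B s) *m r s = (lam t - lam s) *: (l t *m r s).
  rewrite mulmxBr mulmxBl lB -mulmxA Br -scalemxAl -scalemxAr.
  by rewrite scalerBl.
have -> : (lam t - lam s) * pairing s t = ((lam t - lam s) *: (l t *m r s)) 0 0.
  by rewrite [RHS]mxE; congr (_ * _); rewrite mxE.
rewrite -E mxE exchange_big /=; apply: eq_bigr => j _.
rewrite mxE mulr_suml; apply: eq_bigr => i _.
by rewrite !mxE mulrAC.
Qed.

Let lam_ge0 s : 0 <= lam s.
Proof.
have := congr1 (fun u : 'cV_n => u i0 0) (Br s); rewrite !mxE => h.
rewrite -(pmulr_lge0 _ (r0 s i0)) -h sumr_ge0 // => j _.
by rewrite mulr_ge0 ?B0 // ltW.
Qed.

Let lam_continuous : continuous lam.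
Proof.
move=> s; apply/(@cvgrPdist_le _ _ _ (nbhs s)) => e e0.
have d0 : 0 < e / (lam s + 1) by rewrite divr_gt0 // ltr_wpDl.
near=> t.
have hB : forall i j, `|B t i j - B s i j| <= e / (lam s + 1) * B s i j.
  by near: t; exact: Bnear.
rewrite distrC -(ler_pM2r (pairing_gt0 s t)).
rewrite -[X in _ * X <= _](gtr0_norm (pairing_gt0 s t)) -normrM lam_secant.
(* Nothing is known yet about how [l t] varies. The relative bound on [B] compares the double sum
   with [lam s * pairing s t], and the pairing cancels. *)
apply: (@le_trans _ _ (e / (lam s + 1) * (lam s * pairing s t))).
  have -> : lam s * pairing s t = \sum_i \sum_j l t 0 i * r s j 0 * B s i j.
    rewrite /pairing mulr_sumr; apply: eq_bigr => i _.
    rewrite mulrCA; have := congr1 (fun u : 'cV_n => u i 0) (Br s).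
    rewrite !mxE => <-; rewrite mulr_sumr; apply: eq_bigr => j _.
    by rewrite mulrA mulrAC.
  rewrite mulr_sumr (le_trans (ler_norm_sum _ _ _)) //; apply: ler_sum => i _.
  rewrite mulr_sumr (le_trans (ler_norm_sum _ _ _)) //; apply: ler_sum => j _.
  have lr0 : 0 < l t 0 i * r s j 0 by rewrite mulr_gt0.
  by rewrite normrM gtr0_norm // mulrCA ler_pM2l.
rewrite mulrA ler_pM2r // -mulrA ler_piMr ?(ltW e0) //.
by rewrite mulrC ler_pdivrMr ?mul1r ?ler_wpDr // ltr_wpDl.
Unshelve. all: by end_near.
Qed.

(** If [u M = 0], pairing with [r], which [B - lam] kills and whose coordinates sum to 1, shows that
    the coordinates of [u] sum to 0. Then [u] is a left eigenvector, hence a multiple of [l], and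
    its zero sum makes it vanish. *)
Let M_unit t : M t \in unitmx.
Proof.
rewrite -row_free_unit; apply/inj_row_free => u uM.
have uJ : u *m const_mx 1 = const_mx (\sum_i u 0 i) :> 'rV_n.
  by apply/rowP => i; rewrite !mxE; apply: eq_bigr => j _; rewrite mxE mulr1.
have su : \sum_i u 0 i = 0.
  have : (u *m M t *m r t) 0 0 = 0 by rewrite uM mul0mx mxE.
  rewrite mulmxDr mulmxDl uJ mulmxBr mulmxBl.
  rewrite -mulmxA Br mul_mx_scalar -scalemxAr -scalemxAl subrr add0r mxE.
  under eq_bigr do rewrite mxE.
  by rewrite -mulr_sumr r1 mulr1.
have uB : u *m B t = lam t *: u.
  apply/eqP; rewrite -subr_eq0 -mul_mx_scalar -mulmxBr.
  have -> : B t - (lam t)%:M = M t - const_mx 1 by rewrite /M addrK.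
  by rewrite mulmxBr uM uJ su sub0r; apply/eqP/rowP => i; rewrite !mxE oppr0.
have [|||||c uE] := @perron_frobenius_unique R n i0 (B t)^T (lam t) (l t)^T u^T.
- by move=> i j; rewrite mxE; exact: B0.
- exact: irreducible_mx_tr.
- by move=> i; rewrite mxE.
- by rewrite -trmx_mul lB linearZ.
- by rewrite -trmx_mul uB linearZ.
have uE' i : u 0 i = c * l t 0 i.
  by have := congr1 (fun v : 'cV_n => v i 0) uE; rewrite !mxE.
have c0 : c = 0.
  by move: su; under eq_bigr do rewrite uE'; rewrite -mulr_sumr l1 mulr1.
by apply/rowP => i; rewrite uE' c0 mul0r mxE.
Qed.

(* The normalization makes l and r solutions of invertible linear systems. *)
Let lE t : l t = const_mx 1 *m invmx (M t).
Proof.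
rewrite -[LHS](mulmxK (M_unit t)); congr (_ *m _).
rewrite /M mulmxDr mulmxBr lB mul_mx_scalar subrr add0r.
apply/rowP => i; rewrite !mxE -[RHS](l1 t).
by apply: eq_bigr => j _; rewrite mxE mulr1.
Qed.

Let rE t : r t = invmx (M t) *m const_mx 1.
Proof.
rewrite -[LHS](mulKmx (M_unit t)); congr (_ *m _).
rewrite /M mulmxDl mulmxBl Br mul_scalar_mx subrr add0r.
apply/colP => i; rewrite !mxE -[RHS](r1 t).
by apply: eq_bigr => j _; rewrite mxE mul1r.
Qed.

Let Cn_eigenvectors k : Cn k lam ->
  (forall i, Cn k (fun t => l t 0 i)) /\ (forall i, Cn k (fun t => r t i 0)).
Proof.
move=> clam; have cV : forall i j, Cn k (fun t => invmx (M t) i j).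
  apply: Cn_invmx => // i j.
  rewrite (_ : (fun t => _) = fun t => B t i j - lam t * (i == j)%:R + 1).
    apply: CnD; last exact: Cn_cst.
    by apply: CnB => //; apply: CnM => //; exact: Cn_cst.
  by apply/funext => t; rewrite !mxE mulr_natr.
split=> i.
  rewrite (_ : (fun t => _) = fun t => \sum_j invmx (M t) j i).
    by apply: Cn_sum.
  by apply/funext => t; rewrite lE mxE; apply: eq_bigr => j _; rewrite mxE mul1r.
rewrite (_ : (fun t => _) = fun t => \sum_j invmx (M t) i j).
  by apply: Cn_sum.
by apply/funext => t; rewrite rE mxE; apply: eq_bigr => j _; rewrite mxE mulr1.
Qed.

Lemma Cn_perron k : [/\ Cn k lam, forall i, Cn k (fun t => l t 0 i) &
  forall i, Cn k (fun t => r t i 0)].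
Proof.
suff clam : Cn k lam by have [] := Cn_eigenvectors clam.
elim: k => [|k IH]; first exact: lam_continuous.
have [cl cr] := Cn_eigenvectors IH.
(* With [s] fixed, these secant coefficients are continuous in [t], which makes [lam]
   differentiable; on the diagonal [t = s] they are of class [C^k] in [s], which raises [lam] to
   class [C^(k+1)]. *)
pose a s (ij : 'I_n * 'I_n) t := l t 0 ij.1 * r s ij.2 0 / pairing s t.
have cpair s : continuous (pairing s).
  apply: (@Cn_continuous _ _ k); apply: Cn_sum => i _.
  by apply: CnM => //; exact: Cn_cst.
have h s : differentiable lam s /\ forall j, partial j lam s =
    \sum_ij a s ij s * partial j (fun t => B t ij.1 ij.2) s.
  apply: secant_differentiable.
  - move=> ij; apply: continuousM.
      apply: continuousM; last exact: cst_continuous.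
      exact: (Cn_continuous (cl _)).
    exact: (cvgV (lt0r_neq0 (pairing_gt0 s s)) (cpair s s)).
  - by move=> ij; apply: (Cn_differentiable (n := 0)); exact: BC.
  - move=> t; apply: (mulIf (lt0r_neq0 (pairing_gt0 s t))).
    rewrite lam_secant pair_big mulr_suml; apply: eq_bigr => ij _.
    by rewrite [RHS]mulrAC /a divfK // lt0r_neq0.
split=> [s|j]; first by have [] := h s.
rewrite (_ : partial j lam = fun s =>
  \sum_ij a s ij s * partial j (fun t => B t ij.1 ij.2) s); last first.
  by apply/funext => s; have [_] := h s.
apply: Cn_sum => ij _; apply: CnM.
  apply: CnM; first exact: CnM.
  apply: CnV => [s|]; first exact: lt0r_neq0.
  by apply: Cn_sum => i _; exact: CnM.
by have [_ pB] := BC k.+1 ij.1 ij.2; exact: pB.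
Qed.

End PerronFamily.

(** * The exponential family of transition matrices *)

Lemma psumr_gt0_ex (R : realType) (I : finType) (F : I -> R) :
  0 < \sum_i F i -> exists i, 0 < F i.
Proof.
move=> h; apply/existsP; apply: contraTT h => /existsPn h.
by rewrite -leNgt; apply: sumr_le0 => i _; rewrite leNgt h.
Qed.

(** Positivity of an entry of a power depends only on the support; this carries irreducibility from
    [W] to its tilted matrices. *)
Lemma mxX_gt0_support (R : realType) n (A A' : 'M[R]_n) k i j :
  nonneg_mx A -> nonneg_mx A' -> (forall i j, 0 < A i j -> 0 < A' i j) ->
  0 < (A ^+ k) i j -> 0 < (A' ^+ k) i j.
Proof.
move=> A0 A'0 AA'; elim: k i j => [|k IH] i j; first by rewrite !expr0.
rewrite !exprS mxE => /psumr_gt0_ex[l Al].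
have Ail : 0 < A i l.
  by rewrite lt0r A0 andbT; apply: contraTneq Al => ->; rewrite mul0r ltxx.
rewrite mxE (bigD1 l) //= ltr_wpDr //.
  by apply: sumr_ge0 => m _; rewrite mulr_ge0 //; exact: nonneg_mxX.
by rewrite mulr_gt0 ?AA' // IH //; move: Al; rewrite pmulr_rgt0.
Qed.

(** * The chosen eigenvectors and their common eigenvalue *)

Section PFEigenvector.
Context {R : realType} {X : finType}.
Variables (x0 : X) (A : X -> X -> R).
Hypothesis A0 : forall x x', 0 <= A x x'.
Hypothesis Airr : irreducible_mx (mx_of A).

Let At x x' := A x' x.

Lemma mx_of_tr : mx_of At = (mx_of A)^T.
Proof. by apply/matrixP => i j; rewrite !mxE. Qed.

Lemma sum_enum_val (F : X -> R) : \sum_x F x = \sum_(i < #|X|) F (enum_val i).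
Proof.
rewrite (reindex (@enum_val X xpredT)) //=.
by exists enum_rank => x _; [exact: enum_valK|exact: enum_rankK].
Qed.

(** Existence applied to [A] and to its transpose gives two eigenvalues; evaluating [l A r] in both
    ways identifies them, as [l r > 0]. *)
Let pf_both : exists (rho : R) (l : 'rV[R]_#|X|) (r : 'cV[R]_#|X|),
  [/\ forall i, 0 < l 0 i, forall i, 0 < r i 0, l *m mx_of A = rho *: l &
      mx_of A *m r = rho *: r].
Proof.
have nA : nonneg_mx (mx_of A) by move=> i j; rewrite mxE.
have nAt : nonneg_mx (mx_of A)^T by move=> i j; rewrite !mxE.
have [rho [r [r0 rA]]] := perron_frobenius (enum_rank x0) nA Airr.
have [rho' [l [l0 lA]]] :=
  perron_frobenius (enum_rank x0) nAt (irreducible_mx_tr Airr).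
exists rho, l^T, r; split=> //; first by move=> i; rewrite mxE.
have lA' : l^T *m mx_of A = rho' *: l^T.
  by apply: trmx_inj; rewrite trmx_mul trmxK lA linearZ /= trmxK.
suff <- : rho' = rho by [].
have lr : 0 < (l^T *m r) 0 0.
  rewrite mxE (bigD1 (enum_rank x0)) //= ltr_wpDr ?mulr_gt0 ?mxE //.
  by apply: sumr_ge0 => i _; rewrite mxE mulr_ge0 // ltW.
apply: (mulIf (lt0r_neq0 lr)).
have h : (rho' *: (l^T *m r)) 0 0 = (rho *: (l^T *m r)) 0 0.
  by rewrite scalemxAl -lA' -mulmxA rA scalemxAr.
by move: h; rewrite !mxE.
Qed.

(** Ensures that the choice in [pf_eigenvector] never falls back to the default zero function,
    neither for [A] nor for its transpose. *)
Lemma pf_eigenvector_exists :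
  pf_eigenvalue At = pf_eigenvalue A /\
  is_pf_eigenvector A (pf_eigenvector A) /\
  is_pf_eigenvector At (pf_eigenvector At).
Proof.
have [rho [l [r [l0 r0 lA Ar]]]] := pf_both.
have nA : nonneg_mx (mx_of A) by move=> i j; rewrite mxE.
have nAt : nonneg_mx (mx_of A)^T by move=> i j; rewrite !mxE.
have E : pf_eigenvalue A = rho by exact: (pf_radius (enum_rank x0) nA l0 r0).
have Et : pf_eigenvalue At = rho.
  rewrite /pf_eigenvalue mx_of_tr.
  apply: (pf_radius (enum_rank x0) nAt (l := r^T) (v := l^T)).
  - by move=> i; rewrite mxE.
  - by move=> i; rewrite mxE.
  - by rewrite -trmx_mul Ar linearZ.
  - by rewrite -trmx_mul lA linearZ.
split; first by rewrite E Et.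
split.
  apply: (@xgetPex _ [ffun=> 0] [set v : {ffun X -> R} | is_pf_eigenvector A v]).
  exists [ffun x => r (enum_rank x) 0]; split=> x; rewrite ffunE //.
  have := congr1 (fun u : 'cV_#|X| => u (enum_rank x) 0) Ar.
  rewrite E !mxE => <-; rewrite sum_enum_val; apply: eq_bigr => i _.
  by rewrite mxE enum_rankK ffunE enum_valK.
apply: (@xgetPex _ [ffun=> 0] [set v : {ffun X -> R} | is_pf_eigenvector At v]).
exists [ffun x => l 0 (enum_rank x)]; split=> x; rewrite ffunE //.
have := congr1 (fun u : 'rV_#|X| => u 0 (enum_rank x)) lA.
rewrite Et !mxE => <-; rewrite sum_enum_val; apply: eq_bigr => i _.
by rewrite mxE enum_rankK ffunE enum_valK mulrC.
Qed.

End PFEigenvector.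

(** * Smoothness, exponential form and stationary measure of the family *)

Section ExpFamilyStructure.
Context {R : realType} {X : finType} {d : nat}.
Variables (W : X -> X -> R) (g : 'I_d -> X -> X -> R) (x0 : X).
Hypothesis hW : transition_matrix W.
Hypothesis hWirr : irreducible W.
Implicit Type t : 'rV[R]_d.

Let B t := mx_of (tilted W g t).
Let lam t := pf_eigenvalue (tilted W g t).
Let l t := pf_left W g t.
Let r t : X -> R := pf_eigenvector (tilted W g t).

Let tilted_ge0 t x x' : 0 <= tilted W g t x x'.
Proof. by rewrite mulr_ge0 ?expR_ge0 //; case: hW. Qed.

Let B_ge0 t : nonneg_mx (B t).
Proof. by move=> i j; rewrite mxE. Qed.

Let B_irr t : irreducible_mx (B t).
Proof.
move=> i j; have [k] := hWirr (enum_val i) (enum_val j).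
rewrite /mx_power !enum_valK => kP; exists k.
apply: mxX_gt0_support kP => //; first by move=> a b; rewrite mxE; case: hW.
by move=> a b; rewrite !mxE => Wab; rewrite mulr_gt0 ?expR_gt0.
Qed.

Let B_Cn k i j : Cn k (fun t => B t i j).
Proof.
under eq_fun do rewrite mxE /tilted.
apply: CnM; first exact: Cn_cst.
apply/Cn_expR/Cn_sum => m _; apply: CnM; [exact: Cn_coord|exact: Cn_cst].
Qed.

Let B_near s e : 0 < e -> \forall t \near s,
  forall i j, `|B t i j - B s i j| <= e * B s i j.
Proof.
move=> e0.
suff h : \forall t \near s, forall ij : 'I_#|X| * 'I_#|X|,
    `|B t ij.1 ij.2 - B s ij.1 ij.2| <= e * B s ij.1 ij.2.
  by apply: filterS h => t h i j; exact: (h (i, j)).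
apply: (@filter_forall _ _ (fun ij : 'I_#|X| * 'I_#|X| => [set t |
  `|B t ij.1 ij.2 - B s ij.1 ij.2| <= e * B s ij.1 ij.2]) (nbhs s) _) => -[i j] /=.
(* [E t] is the factor that takes the entry at [s] to the entry at [t]: continuous, and equal to 1
   at [s]. *)
pose E t : R := expR (\sum_k (t 0 k - s 0 k) * g k (enum_val i) (enum_val j)).
have cE : {for s, continuous E}.
  apply: (@Cn_continuous _ _ 0); apply/Cn_expR/Cn_sum => k _.
  by apply: CnM; [apply: CnB; [exact: Cn_coord|exact: Cn_cst]|exact: Cn_cst].
have BE t : B t i j = B s i j * E t.
  rewrite !mxE /tilted -mulrA -expRD -big_split /=; congr (_ * expR _).
  by apply: eq_bigr => k _; rewrite -mulrDl addrC subrK.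
have Es : E s = 1.
  by rewrite /E big1 ?expR0 // => k _; rewrite subrr mul0r.
move/cvgrPdist_le : cE => /(_ _ e0).
apply: filterS => t; rewrite Es distrC => h.
rewrite /= BE (_ : _ - _ = B s i j * (E t - 1)); last by rewrite mulrBr mulr1.
by rewrite normrM (ger0_norm (B_ge0 _ _ _)) mulrC ler_wpM2r ?B_ge0.
Qed.

Let r_gt0 t x : 0 < r t x.
Proof.
have [_ [[h _] _]] := pf_eigenvector_exists x0 (tilted_ge0 t) (B_irr t).
exact: h.
Qed.

Let rE t x : \sum_x' tilted W g t x x' * r t x' = lam t * r t x.
Proof.
have [_ [[_ h] _]] := pf_eigenvector_exists x0 (tilted_ge0 t) (B_irr t).
exact: h.
Qed.

Let l_gt0 t x : 0 < l t x.
Proof.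
have [_ [_ [h _]]] := pf_eigenvector_exists x0 (tilted_ge0 t) (B_irr t).
exact: h.
Qed.

Let lE t x : \sum_x' tilted W g t x' x * l t x' = lam t * l t x.
Proof.
have [E [_ [_ h]]] := pf_eigenvector_exists x0 (tilted_ge0 t) (B_irr t).
rewrite /lam -E; exact: h.
Qed.

Let lam_gt0 t : 0 < lam t.
Proof.
have [W0 W1] := hW.
have [x Wx] : exists x, 0 < W x x0 by apply: psumr_gt0_ex; rewrite W1.
rewrite -(pmulr_lgt0 _ (r_gt0 t x)) -rE (bigD1 x0) //= ltr_wpDr //.
  by apply: sumr_ge0 => y _; rewrite mulr_ge0 // ltW.
by rewrite mulr_gt0 // mulr_gt0 // expR_gt0.
Qed.

Let sum_gt0 (f : X -> R) : (forall x, 0 < f x) -> 0 < \sum_x f x.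
Proof.
move=> f0; rewrite (bigD1 x0) //= ltr_wpDr // sumr_ge0 // => x _; exact: ltW.
Qed.

(** The eigenvector is chosen separately at each [t], up to a positive factor; dividing by its sum
    removes this freedom and makes the dependence on [t] smooth. *)
Let L x t := ln (l t x / \sum_y l t y).

Let perronC k : [/\ Cn k lam, forall x, Cn k (fun t => l t x / \sum_y l t y) &
  forall x, Cn k (fun t => r t x / \sum_y r t y)].
Proof.
pose lm t : 'rV[R]_#|X| := \row_i (l t (enum_val i) / \sum_y l t y).
pose rm t : 'cV[R]_#|X| := \col_i (r t (enum_val i) / \sum_y r t y).
have [] := @Cn_perron R d #|X| (enum_rank x0) B lam lm rm B_ge0 B_irr B_Cn B_near
  _ _ _ _ _ _ k.
- move=> t i; rewrite mxE; exact: divr_gt0 (l_gt0 _ _) (sum_gt0 (l_gt0 _)).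
- move=> t i; rewrite mxE; exact: divr_gt0 (r_gt0 _ _) (sum_gt0 (r_gt0 _)).
- move=> t; apply/rowP => i; rewrite !mxE.
  rewrite mulrA -lE mulr_suml [RHS]sum_enum_val; apply: eq_bigr => j _.
  by rewrite !mxE [LHS]mulrC mulrA.
- move=> t; apply/colP => i; rewrite !mxE.
  rewrite mulrA -rE mulr_suml [RHS]sum_enum_val; apply: eq_bigr => j _.
  by rewrite !mxE mulrA.
- move=> t; under eq_bigr do rewrite mxE.
  by rewrite -mulr_suml -sum_enum_val; exact: divff (lt0r_neq0 (sum_gt0 (l_gt0 t))).
- move=> t; under eq_bigr do rewrite mxE.
  by rewrite -mulr_suml -sum_enum_val; exact: divff (lt0r_neq0 (sum_gt0 (r_gt0 t))).
move=> cl cll crr; split=> // x.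
  have := cll (enum_rank x); congr Cn; apply/funext => t.
  by rewrite mxE enum_rankK.
have := crr (enum_rank x); congr Cn; apply/funext => t.
by rewrite mxE enum_rankK.
Qed.

Lemma Cn_potential k : Cn k (potential W g).
Proof. by apply: Cn_ln => [t|]; [exact: lam_gt0|case: (perronC k)]. Qed.

(** The exponential form on which all derivatives are computed; the normalizing sum in [L] cancels
    between [x] and [x']. *)
Lemma exp_family_log : exists L : X -> 'rV[R]_d -> R,
  (forall k x, Cn k (L x)) /\
  forall t x x', exp_family W g t x x' =
    W x x' * expR (\sum_j t 0 j * g j x x' - potential W g t + L x t - L x' t).
Proof.
exists L; split=> [k x|t x x'].
  apply: Cn_ln => [t|]; first exact: divr_gt0 (l_gt0 _ _) (sum_gt0 (l_gt0 _)).
  have [_ h _] := perronC k; exact: h.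
have s0 := sum_gt0 (l_gt0 t).
have lp y : l t y / (\sum_y l t y) \is Num.pos by exact: divr_gt0 (l_gt0 _ _) s0.
have lam0 := lam_gt0 t; have lx0 := l_gt0 t x; have lx'0 := l_gt0 t x'.
rewrite !expRD !expRN /L (lnK (lp x)) (lnK (lp x')) /potential -/(lam t) (lnK lam0).
rewrite /exp_family -/(lam t) -/(l t) /tilted.
move: (lam t) (l t x) (l t x') (\sum_y l t y) (expR _) lam0 lx0 lx'0 s0.
move=> a b b' s E a0 b0 b'0 s0.
by field; rewrite !lt0r_neq0.
Qed.

Lemma exp_family_sum1 t x' : \sum_x exp_family W g t x x' = 1.
Proof.
rewrite /exp_family -mulr_suml.
under eq_bigr do rewrite -mulrA.
rewrite -mulr_sumr.
under eq_bigr do rewrite mulrC.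
rewrite -/(l t) lE mulrA (mulVf (lt0r_neq0 (lam_gt0 t))) mul1r.
exact: divff (lt0r_neq0 (l_gt0 t x')).
Qed.

Lemma exp_family_stationary t : exists p : X -> R, (forall x, 0 < p x) /\
  forall x, \sum_x' exp_family W g t x x' * p x' = p x.
Proof.
(* The product of the left and right eigenvectors is stationary; its total mass is left
   unnormalized. *)
exists (fun x => l t x * r t x); split=> x.
  exact: mulr_gt0 (l_gt0 t x) (r_gt0 t x).
rewrite /exp_family -/(lam t) -/(l t).
rewrite (eq_bigr (fun x' => (lam t)^-1 * l t x * (tilted W g t x x' * r t x'))).
  by rewrite -mulr_sumr rE mulrACA (mulVf (lt0r_neq0 (lam_gt0 t))) mul1r.
by move=> x' _; rewrite !mulrA (mulfVK (lt0r_neq0 (l_gt0 t x'))).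
Qed.

End ExpFamilyStructure.

(** * The score and the Hessian of the potential *)

Lemma hessianE (R : realType) d (f : 'rV[R]_d -> R) t i j :
  hessian f t i j = partial i (partial j f) t.
Proof. by rewrite mxE. Qed.

(** The second hypothesis is the derivative of [sum_x v s2 = 0], where [v] has derivative [v s1] and
    [s2] has derivative [- H + h x - h']. *)
Lemma centered_covariance (R : realType) (X : finType) (v h s1 s2 : X -> R) (H h' : R) :
  \sum_x v x = 1 ->
  \sum_x (v x * (- H + h x - h') + s2 x * (v x * s1 x)) = 0 ->
  \sum_x v x * (s1 x * s2 x) = H + h' - \sum_x v x * h x.
Proof.
move=> v1.
have -> : \sum_x (v x * (- H + h x - h') + s2 x * (v x * s1 x)) =
  (\sum_x v x) * (- H - h') + \sum_x v x * h x + \sum_x v x * (s1 x * s2 x).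
  rewrite mulr_suml -!big_split /=; apply: eq_bigr => x _; ring.
rewrite v1; lra.
Qed.

(** Under a stationary [p] the coboundary [h x' - sum_x V h] averages to zero, so only [H]
    remains. *)
Lemma stationary_average (R : realType) (X : finType) (V s : X -> X -> R)
    (p h : X -> R) (H : R) :
  (forall x, \sum_x' V x x' * p x' = p x) ->
  (forall x', \sum_x V x x' * s x x' = H + h x' - \sum_x V x x' * h x) ->
  (\sum_x p x) * H = \sum_x' \sum_x p x' * V x x' * s x x'.
Proof.
move=> p1 Vs.
have -> : \sum_x' \sum_x p x' * V x x' * s x x' =
    \sum_x' p x' * (H + h x' - \sum_x V x x' * h x).
  apply: eq_bigr => x' _; rewrite -Vs mulr_sumr.
  by apply: eq_bigr => x _; rewrite mulrA.
under [RHS]eq_bigr do rewrite mulrBr mulrDr.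
rewrite !big_split /= -mulr_suml -addrA.
suff -> : \sum_x' - (p x' * \sum_x V x x' * h x) =
    - \sum_x' p x' * h x' by rewrite subrr addr0.
rewrite sumrN; congr (- _).
under eq_bigr do rewrite mulr_sumr.
rewrite exchange_big /=; apply: eq_bigr => x _.
rewrite -[in RHS]p1 mulr_suml; apply: eq_bigr => x' _; ring.
Qed.

(** Averaged products form a Gram matrix, whose quadratic form is an average of squares. *)
Lemma quadratic_form_average (R : realType) (X : finType) d (q : X -> X -> R)
    (s : 'I_d -> X -> X -> R) (u : 'rV[R]_d) (z : R) (H : 'M[R]_d) :
  (forall i j, z * H i j = \sum_x' \sum_x q x' x * (s i x x' * s j x x')) ->
  z * (\sum_i \sum_j u 0 i * u 0 j * H i j) =
  \sum_x' \sum_x q x' x * (\sum_i u 0 i * s i x x') ^+ 2.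
Proof.
move=> HE; transitivity (\sum_i \sum_j \sum_x' \sum_x
    q x' x * ((u 0 i * s i x x') * (u 0 j * s j x x'))).
  rewrite mulr_sumr; apply: eq_bigr => i _; rewrite mulr_sumr.
  apply: eq_bigr => j _; rewrite mulrCA HE mulr_sumr.
  apply: eq_bigr => x' _; rewrite mulr_sumr.
  by apply: eq_bigr => x _; ring.
under eq_bigr do rewrite exchange_big /=.
rewrite exchange_big /=; apply: eq_bigr => x' _.
under eq_bigr do rewrite exchange_big /=.
rewrite exchange_big /=; apply: eq_bigr => x _.
rewrite expr2 mulr_suml mulr_sumr; apply: eq_bigr => i _.
rewrite mulr_sumr mulr_sumr; apply: eq_bigr => j _; ring.
Qed.

(** * Derivatives of the transition probabilities *)

Section Score.
Context {R : realType} {X : finType} {d : nat}.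
Variables (W : X -> X -> R) (g : 'I_d -> X -> X -> R).
Variables (phi : 'rV[R]_d -> R) (L : X -> 'rV[R]_d -> R).
Variable V : 'rV[R]_d -> X -> X -> R.
Hypothesis phiC : Cn 2 phi.
Hypothesis LC : forall x, Cn 2 (L x).
Hypothesis VE : forall t x x', V t x x' =
  W x x' * expR (\sum_j t 0 j * g j x x' - phi t + L x t - L x' t).
Hypothesis V1 : forall t x', \sum_x V t x x' = 1.
Implicit Type t : 'rV[R]_d.

Definition score i t x x' : R :=
  g i x x' - partial i phi t + partial i (L x) t - partial i (L x') t.

Let dphi t : differentiable phi t.
Proof. by case: phiC. Qed.
Let dL x t : differentiable (L x) t.
Proof. by case: (LC x). Qed.
Let d2phi i t : differentiable (partial i phi) t.
Proof. by case: phiC => _ /(_ i)[]. Qed.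
Let d2L i x t : differentiable (partial i (L x)) t.
Proof. by case: (LC x) => _ /(_ i)[]. Qed.

Definition log_rate t x x' : R := \sum_j t 0 j * g j x x' - phi t + L x t - L x' t.

Let dlin x x' t : differentiable (fun t => \sum_j t 0 j * g j x x') t.
Proof.
apply: differentiable_bigsum => j; apply: differentiableM.
  exact: differentiable_coord.
exact: differentiable_cst.
Qed.

Let plin i x x' t : partial i (fun t => \sum_j t 0 j * g j x x') t = g i x x'.
Proof.
have dj j : differentiable (fun t : 'rV[R]_d => t 0 j * g j x x') t.
  by apply: differentiableM; [exact: differentiable_coord|exact: differentiable_cst].
rewrite partial_sum // (bigD1 i) //= big1 => [|j ji]; rewrite partialM.
- rewrite partial_cst mulr0 add0r partial_coord eqxx mulr1 addr0 //.
- exact: differentiable_coord.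
- exact: differentiable_cst.
- by rewrite partial_cst mulr0 add0r partial_coord (negbTE ji) mulr0.
- exact: differentiable_coord.
- exact: differentiable_cst.
Qed.

Lemma log_rate_differentiable x x' t : differentiable (fun t => log_rate t x x') t.
Proof.
apply: differentiableB => //; apply: differentiableD => //.
exact: differentiableB.
Qed.

Lemma partial_log_rate i x x' t :
  partial i (fun t => log_rate t x x') t = score i t x x'.
Proof.
rewrite /log_rate partialD; first last.
- exact: differentiableN.
- by apply: differentiableD => //; exact: differentiableB.
rewrite partialN // partialD //; last exact: differentiableB.
by rewrite partialD ?partialN ?plin //; exact: differentiableN.
Qed.

Let VE' x x' : (fun t => V t x x') = (fun t => W x x' * expR (log_rate t x x')).
Proof. by apply/funext => t; rewrite VE. Qed.

Lemma transition_differentiable x x' t : differentiable (fun t => V t x x') t.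
Proof.
rewrite VE'; apply: differentiableM; first exact: differentiable_cst.
exact/differentiable_expR/log_rate_differentiable.
Qed.

(** Valid also off the support of [W], where both sides vanish. *)
Lemma partial_transition i x x' t :
  partial i (fun t => V t x x') t = V t x x' * score i t x x'.
Proof.
have dl := log_rate_differentiable x x' t.
rewrite VE' partialM; [|exact: differentiable_cst|exact: differentiable_expR].
by rewrite partial_cst mulr0 addr0 partial_expR // partial_log_rate mulrA VE.
Qed.

Lemma score_mean i t x' : \sum_x V t x x' * score i t x x' = 0.
Proof.
under eq_bigr do rewrite -partial_transition.
rewrite -(partial_sum (index_enum X) i (f := fun x t => V t x x')) => [|x];
  last exact: transition_differentiable.
by under eq_fun do rewrite V1; exact: partial_cst.
Qed.

Let dscore j x x' t : differentiable (fun t => score j t x x') t.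
Proof.
apply: differentiableB => //; apply: differentiableD => //.
by apply: differentiableB => //; exact: differentiable_cst.
Qed.

Let pscore i j x x' t : partial i (fun t => score j t x x') t =
  - hessian phi t i j + hessian (L x) t i j - hessian (L x') t i j.
Proof.
rewrite /score partialD; first last.
- exact: differentiableN.
- apply: differentiableD => //; exact: differentiableB.
rewrite partialN // partialD //; last first.
  by apply: differentiableB => //; exact: differentiable_cst.
rewrite partialD; [|exact: differentiable_cst|exact: differentiableN].
rewrite partial_cst add0r (partialN i (d2phi j t)).
rewrite -(hessianE phi t i j).
rewrite -(hessianE (L x) t i j).
rewrite -(hessianE (L x') t i j).
reflexivity.
Qed.

(* Differentiating [sum_x V * score_j = 0] once more along [i]. *)
Lemma score_covariance i j t x' :
  \sum_x V t x x' * (score i t x x' * score j t x x') =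
  hessian phi t i j + hessian (L x') t i j
    - \sum_x V t x x' * hessian (L x) t i j.
Proof.
have : partial i (fun t => \sum_x V t x x' * score j t x x') t = 0.
  by under eq_fun do rewrite score_mean; exact: partial_cst.
have dV := transition_differentiable.
have dVs x : differentiable (fun t => V t x x' * score j t x x') t.
  exact: differentiableM.
rewrite (partial_sum _ _ (f := fun x t => V t x x' * score j t x x')) //.
under eq_bigr do rewrite partialM // pscore partial_transition.
exact: centered_covariance.
Qed.

Section Stationary.
Variables (p : X -> R) (t : 'rV[R]_d).
Hypothesis p0 : forall x, 0 < p x.
Hypothesis p1 : forall x, \sum_x' V t x x' * p x' = p x.

Lemma hessian_stationary i j : (\sum_x p x) * hessian phi t i j =
  \sum_x' \sum_x p x' * V t x x' * (score i t x x' * score j t x x').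
Proof.
apply: (stationary_average (h := fun x => hessian (L x) t i j)
  (s := fun x x' => score i t x x' * score j t x x') p1) => x'.
exact: score_covariance.
Qed.
End Stationary.

End Score.

(** * Positive definiteness of the Hessian *)

Section HessianPositive.
Context {R : realType} {X : finType} {d : nat}.
Variables (W : X -> X -> R) (g : 'I_d -> X -> X -> R).
Variables (phi : 'rV[R]_d -> R) (L : X -> 'rV[R]_d -> R).
Variables (x0 : X) (V : X -> X -> R) (p : X -> R) (t : 'rV[R]_d).
Hypothesis V0 : forall x x', 0 <= V x x'.
Hypothesis WV : forall x x', 0 < W x x' -> 0 < V x x'.
Hypothesis p0 : forall x, 0 < p x.
Hypothesis hg : linearly_independent_under W g.
Hypothesis HE : forall i j, (\sum_x p x) * hessian phi t i j =
  \sum_x' \sum_x p x' * V x x' * (score g phi L i t x x' * score g phi L j t x x').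

Let s0 : 0 < \sum_x p x.
Proof. 
rewrite (bigD1 x0) //= ltr_wpDr // sumr_ge0 // => x _; exact: ltW.
Qed.

(** Symmetry is read off the averaged products in [HE], without exchanging partial derivatives. *)
Lemma hessian_sym : (hessian phi t)^T = hessian phi t.
Proof.
apply/matrixP => i j; rewrite [LHS]mxE; apply: (mulfI (lt0r_neq0 s0)).
rewrite !HE; apply: eq_bigr => x' _; apply: eq_bigr => x _; ring.
Qed.

(** The form is an average of squares of [S = sum_i u_i score_i]. If it were zero, [S] would vanish
    on the support of [W], which displays [sum_j u_j g_j] as a coboundary plus a constant, against
    linear independence. *)
Lemma hessian_pos_def (u : 'rV[R]_d) : u != 0 ->
  0 < \sum_i \sum_j u 0 i * u 0 j * hessian phi t i j.
Proof.
move=> u0; rewrite -(pmulr_rgt0 _ s0).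
rewrite (quadratic_form_average u HE).
pose S x x' := \sum_i u 0 i * score g phi L i t x x'.
have F0 x' x : 0 <= p x' * V x x' * S x x' ^+ 2.
  by rewrite mulr_ge0 ?sqr_ge0 // mulr_ge0 // ltW.
rewrite lt0r; apply/andP; split; last by do 2! apply: sumr_ge0 => ? _.
apply/eqP => E; apply: (hg u0).
exists (fun x => - \sum_i u 0 i * partial i (L x) t),
  (\sum_i u 0 i * partial i phi t) => x x' Wx.
have E1 := psumr_eq0P (fun y' _ => sumr_ge0 _ (fun y _ => F0 y' y)) E.
have E2 := psumr_eq0P (fun y _ => F0 x' y) (E1 x' isT).
have /eqP := E2 x isT.
rewrite mulf_eq0 (gt_eqF (mulr_gt0 (p0 x') (WV Wx))) /= sqrf_eq0 => /eqP Sx.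
have : S x x' = \sum_j u 0 j * g j x x' - \sum_i u 0 i * partial i phi t +
   \sum_i u 0 i * partial i (L x) t - \sum_i u 0 i * partial i (L x') t.
  rewrite -sumrB -big_split -sumrB /=; apply: eq_bigr => i _.
  by rewrite /score; ring.
by rewrite Sx; lra.
Qed.

Lemma hessian_unitmx : hessian phi t \in unitmx.
Proof.
rewrite -row_free_unit; apply/inj_row_free => u uH; apply/eqP.
apply/negPn/negP => /hessian_pos_def; apply/negP; rewrite -leNgt.
rewrite exchange_big /= big1 // => j _.
move: uH; move: (hessian phi t) => H uH.
transitivity ((u *m H) 0 j * u 0 j); last by rewrite uH mxE mul0r.
by rewrite mxE mulr_suml; apply: eq_bigr => i _; ring.
Qed.

End HessianPositive.

(** * Trajectories and their Fisher information *)

Section Paths.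
Context {R : realType} {X : finType}.
Variables (V : X -> X -> R) (P : X -> R).
Hypothesis V0 : forall x x', 0 <= V x x'.
Hypothesis V1 : forall x', \sum_x V x x' = 1.
Hypothesis P0 : forall x, 0 <= P x.
Hypothesis P1 : \sum_x P x = 1.

(** Appends a state at the end of time, so that induction on the length sums over the last
    transition. *)
Definition path_rcons n (w : {ffun 'I_n.+1 -> X}) (x : X) : {ffun 'I_n.+2 -> X} :=
  [ffun i => oapp w x (unlift ord_max i)].

Lemma path_rcons_max n (w : {ffun 'I_n.+1 -> X}) x : path_rcons w x ord_max = x.
Proof. by rewrite ffunE unlift_none. Qed.

Lemma path_rcons_widen n (w : {ffun 'I_n.+1 -> X}) x (k : 'I_n.+1) :
  path_rcons w x (widen_ord (leqnSn n.+1) k) = w k.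
Proof.
have -> : widen_ord (leqnSn n.+1) k = lift ord_max k.
  by apply/val_inj; rewrite /= /bump leqNgt ltn_ord.
by rewrite ffunE liftK.
Qed.

Lemma path_rcons0 n (w : {ffun 'I_n.+1 -> X}) x : path_rcons w x ord0 = w ord0.
Proof.
have E : ord0 = widen_ord (leqnSn n.+1) ord0 :> 'I_n.+2 by exact/val_inj.
exact: etrans (congr1 (path_rcons w x) E) (path_rcons_widen w x ord0).
Qed.

Lemma sum_path_rcons n (F : {ffun 'I_n.+2 -> X} -> R) :
  \sum_w F w = \sum_(w : {ffun 'I_n.+1 -> X}) \sum_x F (path_rcons w x).
Proof.
rewrite pair_big /=.
rewrite (reindex (fun wx : {ffun 'I_n.+1 -> X} * X => path_rcons wx.1 wx.2)) //.
exists (fun w : {ffun 'I_n.+2 -> X} =>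
  ([ffun k => w (widen_ord (leqnSn n.+1) k)] : {ffun 'I_n.+1 -> X}, w ord_max))
  => [[w x]|w] _ /=.
  rewrite path_rcons_max; congr (_, _).
  by apply/ffunP => k; rewrite ffunE path_rcons_widen.
apply/ffunP => i; rewrite ffunE; case: unliftP => [j ->|->] //=.
by rewrite ffunE; congr (w _); apply/val_inj; rewrite /= /bump leqNgt ltn_ord.
Qed.

Lemma sum_path1 (F : {ffun 'I_1 -> X} -> R) :
  \sum_w F w = \sum_x F [ffun=> x].
Proof.
rewrite (reindex (fun x : X => [ffun=> x] : {ffun 'I_1 -> X})) //.
exists (fun w : {ffun 'I_1 -> X} => w ord0) => [x|w] _; first by rewrite ffunE.
by apply/ffunP => i; rewrite ffunE (ord1 i).
Qed.

(** Additive functional with the shape of the logarithm of [path_distribution]; the scores of a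
    trajectory are of this kind. *)
Definition path_sum (a : X -> X -> R) (b : X -> R) n (w : {ffun 'I_n.+1 -> X}) : R :=
  \sum_(k < n) a (w (lift ord0 k)) (w (widen_ord (leqnSn n) k)) + b (w ord0).

Let lift_widen n (k : 'I_n) : lift ord0 (widen_ord (leqnSn n) k) =
  widen_ord (leqnSn n.+1) (lift ord0 k) :> 'I_n.+2.
Proof. exact/val_inj. Qed.

Let lift_max n : lift ord0 (@ord_max n) = @ord_max n.+1.
Proof. exact/val_inj. Qed.

Lemma path_distribution_rcons n (w : {ffun 'I_n.+1 -> X}) x :
  path_distribution V P (path_rcons w x) =
  V x (w ord_max) * path_distribution V P w.
Proof.
rewrite /path_distribution big_ord_recr /= lift_max path_rcons_max path_rcons_widen.
rewrite path_rcons0 mulrA; congr (_ * _); rewrite mulrC; congr (_ * _).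
by apply: eq_bigr => k _; rewrite lift_widen !path_rcons_widen.
Qed.

Lemma path_sum_rcons a b n (w : {ffun 'I_n.+1 -> X}) x :
  path_sum a b (path_rcons w x) = path_sum a b w + a x (w ord_max).
Proof.
rewrite /path_sum big_ord_recr /= lift_max path_rcons_max path_rcons_widen.
rewrite path_rcons0 addrAC; congr (_ + _ + _).
by apply: eq_bigr => k _; rewrite lift_widen !path_rcons_widen.
Qed.

Lemma path_distribution_ge0 n (w : {ffun 'I_n.+1 -> X}) :
  0 <= path_distribution V P w.
Proof. by rewrite mulr_ge0 // prodr_ge0. Qed.

Lemma path_distribution_sum1 n :
  \sum_(w : {ffun 'I_n.+1 -> X}) path_distribution V P w = 1.
Proof.
elim: n => [|n IH].
  rewrite sum_path1 -[RHS]P1; apply: eq_bigr => x _.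
  by rewrite /path_distribution big_ord0 mul1r ffunE.
rewrite sum_path_rcons -[RHS]IH; apply: eq_bigr => w _.
under eq_bigr do rewrite path_distribution_rcons.
by rewrite -mulr_suml V1 mul1r.
Qed.

(* The coboundary [h x' - sum_x V h] telescopes along the trajectory. *)
Lemma path_sum_covariance (a1 a2 : X -> X -> R) (b1 b2 h : X -> R) (c : R) n :
  (forall x', \sum_x V x x' * a1 x x' = 0) ->
  (forall x', \sum_x V x x' * a2 x x' = 0) ->
  (forall x', \sum_x V x x' * (a1 x x' * a2 x x') =
     c + h x' - \sum_x V x x' * h x) ->
  \sum_(w : {ffun 'I_n.+1 -> X}) path_distribution V P w *
     (path_sum a1 b1 w * path_sum a2 b2 w + h (w ord_max)) =
  n%:R * c + \sum_x P x * (b1 x * b2 x + h x).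
Proof.
move=> a10 a20 a12; elim: n => [|n IH].
  rewrite mul0r add0r sum_path1; apply: eq_bigr => x _.
  by rewrite /path_distribution /path_sum !big_ord0 !ffunE mul1r !add0r.
rewrite sum_path_rcons -natr1 mulrDl mul1r addrAC -IH.
(* The constant [c] is spread over the trajectories, of total mass 1, so that the identity can be
   proved for each [w] separately. *)
rewrite -[X in _ + X]mul1r -(path_distribution_sum1 n) mulr_suml -big_split /=.
apply: eq_bigr => w _.
under eq_bigr do rewrite path_distribution_rcons !path_sum_rcons path_rcons_max.
set p := path_distribution V P w; set s1 := path_sum a1 b1 w.
set s2 := path_sum a2 b2 w; set y := w ord_max.
(* The cross terms are isolated; they vanish because [a1] and [a2] are centered. *)
have -> : \sum_x V x y * p * ((s1 + a1 x y) * (s2 + a2 x y) + h x) =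
  p * (s1 * s2 * (\sum_x V x y) + s2 * (\sum_x V x y * a1 x y) +
    s1 * (\sum_x V x y * a2 x y) + \sum_x V x y * (a1 x y * a2 x y) +
    \sum_x V x y * h x).
  rewrite !mulr_sumr -!big_split /= mulr_sumr; apply: eq_bigr => x _; ring.
rewrite V1 a10 a20 a12; ring.
Qed.

(** The bound does not depend on [n]: the telescoped remainder contributes only [O(1)] to the Fisher
    information. *)
Lemma path_expectation_bound (h : X -> R) n :
  `|\sum_(w : {ffun 'I_n.+1 -> X}) path_distribution V P w * h (w ord_max)|
    <= \sum_x `|h x|.
Proof.
rewrite (le_trans (ler_norm_sum _ _ _)) //.
rewrite -[leRHS]mul1r -(path_distribution_sum1 n) mulr_suml; apply: ler_sum => w _.
rewrite normrM ger0_norm ?path_distribution_ge0 // ler_wpM2l ?path_distribution_ge0 //.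
rewrite (bigD1 (w ord_max)) //= lerDl; exact: sumr_ge0.
Qed.

End Paths.

(** * Logarithmic derivatives of products *)

Section LogDerivative.
Context {R : realType} {d : nat}.

Lemma differentiable_prod (I : Type) (s : seq I) (f : I -> 'rV[R]_d -> R) t :
  (forall i, differentiable (f i) t) ->
  differentiable (fun t => \prod_(i <- s) f i t) t.
Proof.
move=> df; elim: s => [|a s IH].
  by under eq_fun do rewrite big_nil; exact: differentiable_cst.
by under eq_fun do rewrite big_cons; exact: differentiableM.
Qed.

(** Logarithmic derivative in multiplied form, so that vanishing factors are allowed. *)
Lemma partial_prod (I : Type) (s : seq I) i (f df : I -> 'rV[R]_d -> R) t :
  (forall k, differentiable (f k) t) ->
  (forall k, partial i (f k) t = f k t * df k t) ->
  partial i (fun t => \prod_(k <- s) f k t) t =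
  \prod_(k <- s) f k t * \sum_(k <- s) df k t.
Proof.
move=> dff pf; elim: s => [|a s IH].
  under eq_fun do rewrite big_nil.
  by rewrite partial_cst !big_nil mulr0.
under eq_fun do rewrite big_cons.
rewrite partialM //; last exact: differentiable_prod.
rewrite IH pf !big_cons; ring.
Qed.

Lemma diff_sum_partial (f : 'rV[R]_d -> R) t v : differentiable f t ->
  'd f t v = \sum_k v 0 k * partial k f t.
Proof.
move=> df; rewrite {1}(row_sum_delta v) linear_sum; apply: eq_bigr => k _.
by rewrite linearZ /partial deriveE.
Qed.

End LogDerivative.

(** * Fisher information of trajectories and change of parameter *)

Section Fisher.
Context {R : realType} {X : finType} {d : nat}.
Variables (V : 'rV[R]_d -> X -> X -> R) (P : 'rV[R]_d -> X -> R).
Variables (a : 'I_d -> X -> X -> R) (t : 'rV[R]_d).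
Hypothesis V0 : forall t x x', 0 <= V t x x'.
Hypothesis P0 : forall t x, 0 <= P t x.
Hypothesis dV : forall x x', differentiable (fun t => V t x x') t.
Hypothesis dP : forall x, differentiable (fun t => P t x) t.
Hypothesis pV : forall i x x', partial i (fun t => V t x x') t = V t x x' * a i x x'.

(** Score of the initial distribution. Where [P t x] is 0 the inverse is 0 by convention, and
    trajectories starting there have probability 0. *)
Let b i x := (P t x)^-1 * partial i (fun t => P t x) t.

Let p n u (w : {ffun 'I_n.+1 -> X}) := path_distribution (V u) (P u) w.

Lemma ln_path_differentiable n (w : {ffun 'I_n.+1 -> X}) : 0 < p t w ->
  differentiable (fun u => ln (p u w)) t.
Proof.
move=> pw; apply: differentiable_ln => //; apply: differentiableM => //.
exact: differentiable_prod.
Qed.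

Lemma partial_ln_path n (w : {ffun 'I_n.+1 -> X}) i : 0 < p t w ->
  partial i (fun u => ln (p u w)) t = path_sum (a i) (b i) w.
Proof.
move=> pw; rewrite (partial_comp _ _ (is_derive1_ln pw)).
rewrite partialM //; last exact: differentiable_prod.
rewrite (partial_prod _ (df := fun k _ =>
  a i (w (lift ord0 k)) (w (widen_ord (leqnSn n) k)))) //.
move: pw; rewrite /p /path_distribution /path_sum /b.
set A := \prod_(_ < _) _; set B := P t _ => AB.
have A0 : A != 0 by apply: contraTneq AB => ->; rewrite mul0r ltxx.
have B0 : B != 0 by apply: contraTneq AB => ->; rewrite mulr0 ltxx.
by field; rewrite A0 B0.
by apply: differentiableM => //; exact: differentiable_prod.
Qed.

(** Trajectories of probability zero contribute zero, so the sum over the support extends to all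
    trajectories. *)
Lemma fisher_information_path n : fisher_information (@p n) t =
  \matrix_(i, j) \sum_(w : {ffun 'I_n.+1 -> X}) p t w *
    (path_sum (a i) (b i) w * path_sum (a j) (b j) w).
Proof.
apply/matrixP => i j; rewrite !mxE [RHS](bigID (fun w => 0 < p t w)) /=.
rewrite [X in _ + X]big1 ?addr0 => [|w].
  by apply: eq_bigr => w pw; rewrite !partial_ln_path.
rewrite -leNgt => pw; have -> : p t w = 0; last by rewrite mul0r.
by apply: le_anti; rewrite pw path_distribution_ge0.
Qed.

(** Chain rule: the scores at [e] are combinations of those at [t], with the rows of the Jacobian
    [K] as coefficients. *)
Lemma fisher_information_reparam n (f : 'rV[R]_d -> 'rV[R]_d) e (K : 'M[R]_d) :
  f e = t -> differentiable f e -> 'd f e = (fun v => v *m K) :> (_ -> _) ->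
  fisher_information (fun e => @p n (f e)) e =
  K *m fisher_information (@p n) t *m K^T.
Proof.
move=> fe df dfE.
have pE w i : 0 < p t w -> partial i (fun e => ln (p (f e) w)) e =
    \sum_k K i k * partial k (fun u => ln (p u w)) t.
  move=> pw; have dl := ln_path_differentiable pw.
  rewrite /partial deriveE; last first.
    by apply: (@differentiable_comp _ _ _ _ f (fun u => ln (p u w))); rewrite ?fe.
  rewrite (@diff_comp _ _ _ _ f (fun u => ln (p u w))) ?fe //= dfE diff_sum_partial //.
  by apply: eq_bigr => k _; rewrite -rowE mxE.
have bilin (D : 'I_d -> R) q i j :
    q * ((\sum_k K i k * D k) * (\sum_k K j k * D k)) =
    \sum_l \sum_k K i k * (q * (D k * D l)) * K j l.
  rewrite exchange_big mulr_suml mulr_sumr; apply: eq_bigr => k _.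
  rewrite mulr_sumr mulr_sumr; apply: eq_bigr => l _; ring.
apply/matrixP => i j; rewrite [LHS]mxE fe.
under eq_bigr => w pw do rewrite !pE //.
rewrite mxE; under [RHS]eq_bigr => l _.
  rewrite mxE mulr_suml.
  under eq_bigr => k _ do
    rewrite [fisher_information _ _ _ _]mxE [K^T _ _]mxE mulr_sumr mulr_suml.
  over.
under [RHS]eq_bigr => l _ do rewrite exchange_big /=.
rewrite [RHS]exchange_big /=; apply: eq_bigr => w pw.
exact: (bilin (fun k => partial k (fun u => ln (p u w)) t)).
Qed.

End Fisher.

(** * Inverting the gradient map *)

Section MatrixNorm.
Context {R : realType}.

Lemma mx_norm_entry_le m n (M : 'M[R]_(m, n)) i j : `|M i j| <= `|M|.
Proof.
rewrite [leRHS]/Num.Def.normr /= mx_normrE.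
by apply: (le_bigmax _ (fun ij => `|M ij.1 ij.2|) (i, j)).
Qed.

Lemma mx_norm_le m n (M : 'M[R]_(m, n)) (e : R) : 0 <= e ->
  (forall i j, `|M i j| <= e) -> `|M| <= e.
Proof.
move=> e0 Me; rewrite [leLHS]/Num.Def.normr /= mx_normrE.
by apply/bigmax_leP; split=> // -[i j] _; exact: Me.
Qed.

Lemma mulmx_norm_le n (K : 'M[R]_n) : exists2 C : R, 0 < C &
  forall v : 'rV_n, `|v *m K| <= C * `|v|.
Proof.
have s0 : 0 <= \sum_i \sum_j `|K i j|.
  by apply: sumr_ge0 => i _; apply: sumr_ge0.
(* The summand 1 keeps the constant strictly positive, as later divisions by it require. *)
exists (1 + \sum_i \sum_j `|K i j|) => [|v]; first by rewrite ltr_pwDl.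
apply: mx_norm_le => [|i j]; first by rewrite mulr_ge0 // addr_ge0.
rewrite mxE (le_trans (ler_norm_sum _ _ _)) // mulrDl mul1r.
rewrite ler_wpDl // mulr_suml; apply: ler_sum => k _.
rewrite normrM mulrC ler_pM ?mx_norm_entry_le // (bigD1 j) //= lerDl.
exact: sumr_ge0.
Qed.

Lemma mulmxr_continuous n (K : 'M[R]_n) : continuous (mulmxr K : 'rV_n -> 'rV_n).
Proof.
have [C C0 CP] := mulmx_norm_le K.
move=> x; apply/(@cvgrPdist_le _ _ _ (nbhs x)) => e e0; near=> y.
rewrite /= -mulmxBl (le_trans (CP _)) // mulrC -ler_pdivlMr //.
by near: y; apply: (@cvgr_dist_le _ _ _ _ _ id x) => //; rewrite divr_gt0.
Unshelve. all: by end_near. Qed.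

End MatrixNorm.

(** * Derivatives along lines *)

Section DirectionalDerivative.
Context {R : realType} {d : nat}.
Implicit Types (F : 'rV[R]_d -> R) (s u : 'rV[R]_d).

Lemma is_derive_line F s u (h : R) : differentiable F (h *: u + s) ->
  is_derive h (1 : R) (fun h : R => F (h *: u + s)) ('D_u F (h *: u + s)).
Proof.
move=> dF.
have E : (fun k : R => k^-1 *: (F ((k *: (1 : R) + h : R) *: u + s) - F (h *: u + s))) =
    (fun k => k^-1 *: (F (k *: u + (h *: u + s)) - F (h *: u + s))).
  apply/funext => k; congr (_ *: (F _ - _)).
  by rewrite [k *: (1 : R)]mulr1 scalerDl addrA.
have D : derivable (fun h : R => F (h *: u + s)) h (1 : R).
  have := @diff_derivable _ _ _ F (h *: u + s) u dF.
  by rewrite /derivable /= E.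
by apply: DeriveDef => //; rewrite /derive /= E.
Qed.

Lemma mean_value_line F s u : (forall t, differentiable F t) ->
  exists h : R, F (u + s) - F s = 'D_u F (h *: u + s).
Proof.
move=> dF.
have [||h _] := @MVT R (fun h : R => F (h *: u + s))
  (fun h : R => 'D_u F (h *: u + s)) 0 1 ltr01.
- by move=> x _; exact: is_derive_line.
- apply: derivable_within_continuous => x _.
  by have [] := is_derive_line (dF (x *: u + s)).
by rewrite scale1r scale0r add0r subr0 mulr1; exists h.
Qed.

Lemma derive_partial F s u : differentiable F s ->
  'D_u F s = \sum_k u 0 k * partial k F s.
Proof. by move=> dF; rewrite deriveE // diff_sum_partial. Qed.

Lemma partial_local_min F s (e : R) k : 0 < e -> (forall t, differentiable F t) ->
  (forall t, `|t - s| < e -> F s <= F t) -> partial k F s = 0.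
Proof.
move=> e0 dF Fs; set u := delta_mx 0 k : 'rV[R]_d.
have u1 : `|u| <= 1.
  apply: mx_norm_le => // i j; rewrite mxE.
  by case: (_ && _); rewrite ?normr1 ?normr0.
have := @derive1_at_min R (fun h : R => F (h *: u + s)) (- e) e 0.
have lee : - e <= e by rewrite (le_trans (y := 0)) ?oppr_le0 ?ltW.
have h0 : 0 \in `]-e, e[%R by rewrite in_itv /= oppr_lt0 e0.
move=> /(_ lee _ h0 _) [||_].
- by move=> h _; have [] := is_derive_line (dF (h *: u + s)).
- move=> h; rewrite in_itv /= => /andP[h1 h2]; rewrite scale0r add0r.
  apply: Fs; rewrite addrK normrZ.
  rewrite (@le_lt_trans _ _ `|h|) //; first by rewrite ler_piMr.
  by rewrite ltr_norml h1.
have [_] := is_derive_line (dF (0 *: u + s)).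
by move=> ->; rewrite scale0r add0r.
Qed.

End DirectionalDerivative.

(** * Injectivity, local surjectivity and inverse of the gradient map *)

Section GradientMap.
Context {R : realType} {d : nat}.
Variable phi : 'rV[R]_d -> R.
Hypothesis phiC : Cn 2 phi.
Hypothesis Hpos : forall t (u : 'rV[R]_d), u != 0 ->
  0 < \sum_i \sum_j u 0 i * u 0 j * hessian phi t i j.
Hypothesis Hunit : forall t, hessian phi t \in unitmx.
Hypothesis Hsym : forall t, (hessian phi t)^T = hessian phi t.

Let eta t : 'rV[R]_d := \row_j partial j phi t.

Let d2phi i t : differentiable (partial i phi) t.
Proof. by case: phiC => _ /(_ i)[]. Qed.

(** If [eta t = eta s] with [u = t - s] nonzero, the function [u . eta] takes equal values at [s]
    and [t], so its derivative along [u], which is the Hessian form at [u], vanishes somewhere on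
    the line, against positivity. *)
Lemma gradient_inj : injective eta.
Proof.
move=> t s ets; apply/eqP; rewrite -subr_eq0; apply/negPn/negP => un0.
set u := t - s in un0.
pose F v := \sum_j u 0 j * partial j phi v.
have dF v : differentiable F v.
  by apply: differentiable_bigsum => j; exact: differentiableM.
have [h] := mean_value_line s u dF.
have -> : F (u + s) - F s = 0.
  rewrite /F subrK; apply/eqP; rewrite subr_eq0; apply/eqP.
  apply: eq_bigr => j _; congr (_ * _).
  by have := congr1 (fun v : 'rV_d => v 0 j) ets; rewrite !mxE.
rewrite derive_partial // => /esym/eqP; rewrite gt_eqF //.
rewrite (_ : \sum_k _ = \sum_i \sum_j u 0 i * u 0 j * hessian phi (h *: u + s) i j);
  first exact: Hpos.
apply: eq_bigr => k _; rewrite partial_sum; last first.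
  by move=> j; apply: differentiableM => //; exact: differentiable_cst.
rewrite mulr_sumr; apply: eq_bigr => j _; rewrite hessianE -mulrA; congr (_ * _).
rewrite partialM //.
by rewrite partial_cst mulr0 addr0.
Qed.

Lemma gradient_eps t0 e : 0 < e -> exists2 r, 0 < r & forall t, `|t - t0| < r ->
  `|eta t - eta t0 - (t - t0) *m hessian phi t0| <= e * `|t - t0|.
Proof.
move=> e0.
have : \forall t \near t0, forall j, `|partial j phi t - partial j phi t0 -
    'd (partial j phi) t0 (t - t0)| <= e * `|t - t0|.
  apply: (@filter_forall _ _ (fun j => [set t | `|partial j phi t -
    partial j phi t0 - 'd (partial j phi) t0 (t - t0)| <= e * `|t - t0|])
    (nbhs t0) _) => j; exact: (diff_eps (d2phi j t0) e0).
move=> /nbhs_ballP[r /= r0 rP]; exists r => // t tr.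
apply: mx_norm_le => [|i j]; first by rewrite mulr_ge0 // ltW.
rewrite ord1.
have := rP t; rewrite -ball_normE /= distrC => /(_ tr j).
rewrite diff_sum_partial //; congr (_ <= _); congr (`| _ |).
rewrite !mxE; congr (_ - _); apply: eq_bigr => k _.
by rewrite hessianE.
Qed.

Let K t := invmx (hessian phi t).

(** Quantitative local injectivity, from the invertibility of the differential. *)
Lemma gradient_expansion t0 : exists2 c, 0 < c & exists2 r, 0 < r &
  forall t, `|t - t0| < r -> `|t - t0| <= c * `|eta t - eta t0|.
Proof.
have [C C0 CP] := mulmx_norm_le (K t0).
(* With this slope the linearization error costs at most [|v| / 2] after multiplication by the
   inverse Hessian, and the left-hand side absorbs it. *)
have e0 : 0 < (2 * C)^-1 by rewrite invr_gt0 mulr_gt0.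
have [r r0 rP] := gradient_eps t0 e0.
exists (2 * C); first by rewrite mulr_gt0.
exists r => // t /rP h.
set D := eta t - eta t0 in h *; set v := t - t0 in h *.
have vE : v = (v *m hessian phi t0) *m K t0 by rewrite mulmxK.
have h1 : `|v| <= C * `|v *m hessian phi t0| by rewrite {1}vE.
have h2 : `|v *m hessian phi t0| <= `|D| + (2 * C)^-1 * `|v|.
  rewrite -[X in `|X|](subKr D) (le_trans (ler_normB _ _)) // lerD2l.
  exact: h.
have h3 : C * ((2 * C)^-1 * `|v|) = `|v| / 2.
  by field; rewrite lt0r_neq0.
have : `|v| <= C * `|D| + `|v| / 2.
  by rewrite -h3 -mulrDr (le_trans h1) // ler_pM2l.
lra.
Qed.

(* A minimum of |eta - y|^2 on a small ball is attained in the interior, where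
   its gradient 2 (eta - y) H vanishes. *)
Lemma gradient_locally_onto t0 r : 0 < r -> exists2 e, 0 < e &
  forall y, `|y - eta t0| < e -> exists2 s, `|s - t0| < r & eta s = y.
Proof.
move=> r0; have [c c0 [r1 r10 cP]] := gradient_expansion t0.
(* Half of the smaller radius puts the closed ball strictly inside both open ones. *)
pose q := Num.min r r1 / 2.
have q0 : 0 < q by rewrite divr_gt0 // lt_min r0.
have qr : q < r.
  by rewrite ltr_pdivrMr // (@le_lt_trans _ _ r) ?ge_min ?lexx // ltr_pMr // ltr1n.
have qr1 : q < r1.
  by rewrite ltr_pdivrMr // (@le_lt_trans _ _ r1) ?ge_min ?lexx ?orbT // ltr_pMr // ltr1n.
(* A minimum [s] on the sphere would give [q <= c (d + 1) |y - eta t0|], where [d] comes from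
   [|eta s - y| <= d |y - eta t0|] and 1 from the triangle inequality; this threshold excludes
   it. *)
exists (q / (c * (d%:R + 2))).
  by rewrite divr_gt0 // mulr_gt0 // ltr_wpDl.
move=> y yP.
pose Q t := \sum_j (partial j phi t - y 0 j) * (partial j phi t - y 0 j).
have dB j t : differentiable (fun t => partial j phi t - y 0 j) t.
  by apply: differentiableB => //; exact: differentiable_cst.
have dQ t : differentiable Q t.
  by apply: differentiable_bigsum => j; exact: differentiableM.
pose S := [set t : 'rV[R]_d | `|t - t0| <= q].
have [||s sS smin] := @EVT_min_rV R d Q S _ _ (continuous_subspaceT
    (fun t => differentiable_continuous (dQ t))).
- by exists t0; rewrite /S /= subrr normr0 ltW.
- apply: bounded_closed_compact.
    exists (q + `|t0|); split=> [|M /ltW hM t tS]; first exact: num_real.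
    apply: le_trans hM; rewrite -[t](subrK t0) (le_trans (ler_normD _ _)) //.
    by rewrite lerD2r.
  apply: closed_le_continuous; last exact: cst_continuous.
  move=> t; apply: (@cvg_norm _ _ _ (nbhs t)).
  by apply: cvgB; [exact: cvg_id|exact: cvg_cst].
have {}sS : `|s - t0| <= q by move: sS; rewrite inE.
set dl := `|y - eta t0| in yP.
have dl0 : 0 <= dl by exact: normr_ge0.
have Qs : Q s <= (d%:R * dl) ^+ 2.
  have /smin : t0 \in S by rewrite inE /S /= subrr normr0 ltW.
  move=> /le_trans; apply.
  apply: (@le_trans _ _ (\sum_(j < d) dl * dl)).
    apply: ler_sum => j _; have := mx_norm_entry_le (y - eta t0) 0 j.
    rewrite -/dl ler_norml !mxE => /andP[].
    move: (partial j phi t0) (y 0 j) => a b; nra.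
  rewrite sumr_const card_ord -(mulr_natl (dl * dl)) -expr2 exprMn ler_wpM2r ?sqr_ge0 //.
  by rewrite -natrX ler_nat; case: (d) => // k; rewrite leq_pmulr.
have etas : `|eta s - y| <= d%:R * dl.
  apply: mx_norm_le => [|i j]; first by rewrite mulr_ge0.
  rewrite ord1 -ler_sqr ?nnegrE ?mulr_ge0 ?normr_ge0 //.
  rewrite (le_trans _ Qs) // -normrX ger0_norm ?sqr_ge0 // !mxE.
  rewrite /Q (bigD1 j) //= expr2 lerDl; apply: sumr_ge0 => k _.
  by rewrite -expr2 sqr_ge0.
have sq : `|s - t0| < q.
  rewrite lt_neqAle sS andbT; apply/eqP => sE.
  have := cP s; rewrite sE => /(_ qr1); apply/negP; rewrite -ltNge.
  have : `|eta s - eta t0| <= (d%:R + 1) * dl.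
    rewrite mulrDl mul1r -[eta s - _](subrKA y).
    by rewrite (le_trans (ler_normD _ _)) // lerD.
  rewrite -(ler_pM2l c0) => /le_lt_trans; apply.
  move: yP; rewrite ltr_pdivlMr; last by rewrite mulr_gt0 // ltr_wpDl.
  apply: le_lt_trans; have := ler0n R d; move: (d%:R : R) => k k0; nra.
exists s; first exact: lt_trans qr.
have ps k : partial k Q s = 0.
  apply: (@partial_local_min _ _ Q s (q - `|s - t0|)) => //; first by rewrite subr_gt0.
  move=> t ht; apply: smin; rewrite inE /S /=.
  rewrite -[t - t0](subrKA s) (le_trans (ler_normD _ _)) //.
  by rewrite -lerBrDr ltW.
have : (eta s - y) *m hessian phi s = 0.
  apply/rowP => k; rewrite !mxE; apply: (@mulfI _ 2%:R); first by rewrite pnatr_eq0.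
  rewrite mulr0; apply: (etrans _ (ps k)).
  rewrite partial_sum; last by move=> j; exact: differentiableM.
  rewrite mulr_sumr; apply: eq_bigr => j _.
  rewrite partialM // partialD //.
  have -> : hessian phi s j k = partial k (partial j phi) s.
    by rewrite -hessianE -[in LHS]Hsym mxE.
  rewrite partial_cst addr0 !mxE; ring.
move=> /(congr1 (fun v => v *m K s)); rewrite mulmxK // mul0mx => /eqP.
by rewrite subr_eq0 => /eqP.
Qed.

(** By local surjectivity every [y] near [eta t0] is [eta s] with [s] near [t0]. The error
    [s - t0 - (y - eta t0) K] is, up to sign, the linearization error of [eta] times [K]: small
    against [|s - t0|], hence against [|y - eta t0|]. *)
Lemma gradient_inverse_diff t0 (f : 'rV[R]_d -> 'rV[R]_d) :
  (forall t, f (eta t) = t) ->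
  differentiable f (eta t0) /\
  'd f (eta t0) = (fun v => v *m K t0) :> ('rV[R]_d -> 'rV[R]_d).
Proof.
move=> fK; apply: (@eps_diff _ _ _ f (eta t0) (mulmxr (K t0))).
  exact: mulmxr_continuous.
move=> e e0.
have [C C0 CP] := mulmx_norm_le (K t0).
have [c c0 [r1 r10 cP]] := gradient_expansion t0.
have e'0 : 0 < e / (C * c) by rewrite divr_gt0 // mulr_gt0.
have [r2 r20 r2P] := gradient_eps t0 e'0.
have r0 : 0 < Num.min r1 r2 by rewrite lt_min r10.
have [dl dl0 dlP] := gradient_locally_onto t0 r0.
apply/nbhs_ballP; exists dl => // y; rewrite -ball_normE /= distrC => /dlP[s].
rewrite lt_min => /andP[/cP h1 /r2P h2] <-; rewrite !fK.
have -> : s - t0 - (eta s - eta t0) *m K t0 =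
    - ((eta s - eta t0 - (s - t0) *m hessian phi t0) *m K t0).
  by rewrite [in RHS]mulmxBl /K mulmxK // opprB.
rewrite normrN (le_trans (CP _)) //.
have : C * (e / (C * c) * `|s - t0|) <= e * `|eta s - eta t0|.
  have -> : e * `|eta s - eta t0| = C * (e / (C * c) * (c * `|eta s - eta t0|)).
    by field; rewrite !lt0r_neq0.
  by rewrite ler_pM2l // ler_pM2l.
by apply: le_trans; rewrite ler_pM2l.
Qed.

End GradientMap.

(** * The limits *)

Section Limits.
Context {R : realType}.

Lemma cvg_div_bounded_defect (u : nat -> R) (c M : R) :
  (forall n, `|u n - n%:R * c| <= M) -> (n%:R^-1 * u n) @[n --> \oo] --> c.
Proof.
move=> uM; apply/cvgrPdist_le => e e0; near=> n.
have n0 : 0 < n%:R :> R by rewrite ltr0n; near: n; exact: nbhs_infty_gt.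
have -> : c - n%:R^-1 * u n = - (n%:R^-1 * (u n - n%:R * c)).
  by field; rewrite lt0r_neq0.
rewrite normrN normrM gtr0_norm ?invr_gt0 // mulrC ler_pdivrMr //.
rewrite (le_trans (uM n)) // mulrC -ler_pdivrMr //.
by near: n; exact: nbhs_infty_ger.
Unshelve. all: by end_near. Qed.

Lemma cvg_mx m k (M : nat -> 'M[R]_(m, k)) (l : 'M[R]_(m, k)) :
  (forall i j, M n i j @[n --> \oo] --> l i j) -> M n @[n --> \oo] --> l.
Proof.
move=> Ml; apply/(@cvgrPdist_le _ _ _ \oo) => e e0.
have : \forall n \near \oo, forall ij : 'I_m * 'I_k,
    `|l ij.1 ij.2 - M n ij.1 ij.2| <= e.
  by apply: filter_forall => -[i j]; move/cvgrPdist_le : (Ml i j); exact.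
apply: filterS => n h; apply: mx_norm_le => [|i j]; first exact: ltW.
by rewrite !mxE; exact: (h (i, j)).
Qed.

Lemma cvg_mx_entry m k (M : nat -> 'M[R]_(m, k)) (l : 'M[R]_(m, k)) i j :
  M n @[n --> \oo] --> l -> M n i j @[n --> \oo] --> l i j.
Proof.
move/(@cvgrPdist_le _ _ _ \oo) => Ml; apply/cvgrPdist_le => e /Ml.
apply: filterS => n; apply: le_trans.
by have := mx_norm_entry_le (l - M n) i j; rewrite !mxE.
Qed.

Lemma cvg_mulmx_sandwich k (M : nat -> 'M[R]_k) (l A B : 'M[R]_k) :
  M n @[n --> \oo] --> l -> (A *m M n *m B) @[n --> \oo] --> A *m l *m B.
Proof.
move=> Ml; apply: cvg_mx => i j.
rewrite mxE; under eq_fun do rewrite mxE.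
apply: cvg_big => [|b _]; first exact: add_continuous.
apply: cvgM; last exact: cvg_cst.
rewrite mxE; under eq_fun do rewrite mxE.
apply: cvg_big => [|a _]; first exact: add_continuous.
by apply: cvgM; [exact: cvg_cst|exact: cvg_mx_entry].
Qed.

End Limits.

Theorem lemma8p3 (R : realType) (X : finType) (d : nat)
    (W : X -> X -> R) (g : 'I_d -> X -> X -> R) (P : 'rV[R]_d -> X -> R)
    (hW : transition_matrix W) (hWirr : irreducible W) (hWerg : ergodic W)
    (hg : linearly_independent_under W g)
    (hP : distribution_family P) (hPsmooth : forall x, smooth (P ^~ x)) :
  let phi := potential W g in
  let eta := expectation_param W g in
  let p (n : nat) (t : 'rV[R]_d) :=
    path_distribution (exp_family W g t) (P t) (n := n) in
  let J (n : nat) (t : 'rV[R]_d) := fisher_information (p n) t in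
  let Jtilde (n : nat) (t : 'rV[R]_d) :=
    fisher_information (fun e => p n (natural_param W g e)) (eta t) in
  forall t : 'rV[R]_d,
    ((fun n : nat => n%:R^-1 *: J n t) @ \oo --> hessian phi t) /\
    ((fun n : nat => n%:R^-1 *: Jtilde n t) @ \oo --> invmx (hessian phi t)).
Proof.
(* An initial distribution sums to 1, so there is at least one state. *)
have /card_gt0P[x0 _] : (0 < #|X|)%N.
  rewrite lt0n; apply/eqP => X0.
  have [_] := hP 0; rewrite big1 => [/esym/eqP|x _]; first by rewrite oner_eq0.
  by have := fintype0 x X0.
have [L [LC VE]] := exp_family_log g x0 hW hWirr.
have phiC := Cn_potential g x0 hW hWirr 2.
have V1 := exp_family_sum1 g x0 hW hWirr.
have V0 t x x' : 0 <= exp_family W g t x x'.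
  by rewrite VE mulr_ge0 ?expR_ge0 //; case: hW.
have WV t x x' : 0 < W x x' -> 0 < exp_family W g t x x'.
  by move=> Wx; rewrite VE mulr_gt0 ?expR_gt0.
have HE t : exists2 q : X -> R, (forall x, 0 < q x) &
    forall i j, (\sum_x q x) * hessian (potential W g) t i j =
    \sum_x' \sum_x q x' * exp_family W g t x x' *
      (score g (potential W g) L i t x x' * score g (potential W g) L j t x x').
  have [q [q0 q1]] := exp_family_stationary g x0 hW hWirr t; exists q => // i j.
  exact: (hessian_stationary phiC (LC 2) VE V1 q1).
have Hsym t : (hessian (potential W g) t)^T = hessian (potential W g) t.
  by have [q q0 qE] := HE t; exact: (hessian_sym x0 q0 qE).
have Hpos t (u : 'rV[R]_d) : u != 0 ->
    0 < \sum_i \sum_j u 0 i * u 0 j * hessian (potential W g) t i j.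
  by have [q q0 qE] := HE t; exact: (hessian_pos_def x0 (V0 t) (WV t) q0 hg qE).
have Hunit t : hessian (potential W g) t \in unitmx.
  by have [q q0 qE] := HE t; exact: (hessian_unitmx x0 (V0 t) (WV t) q0 hg qE).
move=> phi eta p J Jtilde t.
have dV x x' := transition_differentiable phiC (LC 2) VE x x' t.
have pV i x x' := partial_transition phiC (LC 2) VE i x x' t.
have dP x : differentiable (P ^~ x) t := hPsmooth x [::] t.
have P0 s x : 0 <= P s x by case: (hP s).
have Jcvg : (fun n : nat => n%:R^-1 *: J n t) @ \oo --> hessian phi t.
  apply: cvg_mx => i j; under eq_fun do rewrite mxE.
  pose b k x := (P t x)^-1 * partial k (P ^~ x) t.
  pose h x := hessian (L x) t i j.
  (* The defect is the initial term of the covariance identity minus the expectation of [h] at the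
     last state, both bounded independently of [n]. *)
  apply: (@cvg_div_bounded_defect _ _ _
    (`|\sum_x P t x * (b i x * b j x + h x)| + \sum_x `|h x|)) => n.
  rewrite /J (fisher_information_path V0 P0 dV dP pV) mxE.
  have [P0t P1t] := hP t.
  have -> : \sum_(w : {ffun 'I_n.+1 -> X}) path_distribution (exp_family W g t) (P t) w *
      (path_sum (score g phi L i t) (b i) w * path_sum (score g phi L j t) (b j) w) =
    \sum_(w : {ffun 'I_n.+1 -> X}) path_distribution (exp_family W g t) (P t) w *
      (path_sum (score g phi L i t) (b i) w * path_sum (score g phi L j t) (b j) w
        + h (w ord_max)) -
    \sum_(w : {ffun 'I_n.+1 -> X}) path_distribution (exp_family W g t) (P t) w *
      h (w ord_max).
    by rewrite -sumrB; apply: eq_bigr => w _; rewrite -mulrBr addrK.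
  rewrite (path_sum_covariance (V1 t) P1t (b i) (b j) n
    (score_mean phiC (LC 2) VE V1 i t) (score_mean phiC (LC 2) VE V1 j t)
    (score_covariance phiC (LC 2) VE V1 i j t)).
  rewrite addrAC [X in `|X - _|]addrAC subrr add0r (le_trans (ler_normB _ _)) // lerD2l.
  exact: path_expectation_bound.
split=> //.
(* Injectivity of [eta] makes the pseudo-inverse a genuine left inverse, so its default value 0 does
   not occur at points [eta s]. *)
have npK s : natural_param W g (eta s) = s.
  have eta_inj : {in [set: 'rV[R]_d] &, injective eta}.
    by move=> u v _ _; exact: (gradient_inj phiC Hpos).
  exact: (@pinvKV _ _ (fun=> 0) setT eta eta_inj s (mem_set I)).
have [dnp np'] := gradient_inverse_diff phiC Hunit Hsym t npK.
have JtE n : Jtilde n t =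
    invmx (hessian phi t) *m J n t *m (invmx (hessian phi t))^T.
  exact: (@fisher_information_reparam R X d (exp_family W g) P t dV dP n
    (natural_param W g) (eta t) _ (npK t) dnp np').
(* The limit takes the shape [K H K^T] of the reparametrized information, with [K] the inverse
   Hessian, which is symmetric. *)
have -> : invmx (hessian phi t) =
    invmx (hessian phi t) *m hessian phi t *m (invmx (hessian phi t))^T.
  by rewrite mulVmx ?Hunit // mul1mx trmx_inv Hsym.
under eq_fun do rewrite JtE scalemxAl scalemxAr.
exact: cvg_mulmx_sandwich.
Qed.
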